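(* Let $\mathbf{AC}^{\mathbf k}_{\top,\bot}$ be the free bimonoidal intermuting category generated by a nonempty set of objects (letters). If $f,g:A\to B$ are arrows of $\mathbf{AC}^{\mathbf k}_{\top,\bot}$ such that both $A$ and $B$ are pure, or no letter occurs in $A$ and $B$, then $f=g$ in $\mathbf{AC}^{\mathbf k}_{\top,\bot}$.
   Context: Throughout, $\xi\in\{\wedge,\vee\}$; hats mark the natural transformations attached to $\wedge$ and checks those attached to $\vee$. A bimonoidal intermuting category is $\langle\mathcal A,\wedge,\vee,\top,\bot\rangle$ where $\wedge,\vee:\mathcal A\times\mathcal A\to\mathcal A$ are functors, $\top,\bot$ are objects, and there are: (1) natural isomorphisms $\hat b^{\to}_{A,B,C}:A\wedge(B\wedge C)\to(A\wedge B)\wedge C$, $\check b^{\to}_{A,B,C}:A\vee(B\vee C)\to(A\vee B)\vee C$, with inverses $\hat b^{\leftarrow}_{A,B,C},\check b^{\leftarrow}_{A,B,C}$, each satisfying the pentagonal equation $b^{\to}_{A\xi B,C,D}\circ b^{\to}_{A,B,C\xi D}=(b^{\to}_{A,B,C}\,\xi\,\mathbf 1_D)\circ b^{\to}_{A,B\xi C,D}\circ(\mathbf 1_A\,\xi\, b^{\to}_{B,C,D})$; (2) natural isomorphisms $\hat\delta^{\to}_A:A\wedge\top\to A$, $\hat\sigma^{\to}_A:\top\wedge A\to A$, $\check\delta^{\to}_A:A\vee\bot\to A$, $\check\sigma^{\to}_A:\bot\vee A\to A$, with inverses $\hat\delta^{\leftarrow},\hat\sigma^{\leftarrow},\check\delta^{\leftarrow},\check\sigma^{\leftarrow}$,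 with $\hat\delta^{\to}_\top=\hat\sigma^{\to}_\top$, $\check\delta^{\to}_\bot=\check\sigma^{\to}_\bot$, $\hat b^{\to}_{A,\top,C}=\hat\delta^{\leftarrow}_A\wedge\hat\sigma^{\to}_C$, $\check b^{\to}_{A,\bot,C}=\check\delta^{\leftarrow}_A\vee\check\sigma^{\to}_C$; (3) isomorphisms $\hat w^{\leftarrow}_\bot:\bot\to\bot\wedge\bot$ and $\check w^{\to}_\top:\top\vee\top\to\top$, with inverses $\hat w^{\to}_\bot$, $\check w^{\leftarrow}_\top$, satisfying $\check w^{\to}_\top\circ(\check w^{\to}_\top\vee\mathbf 1_\top)\circ\check b^{\to}_{\top,\top,\top}=\check w^{\to}_\top\circ(\mathbf 1_\top\vee\check w^{\to}_\top)$ and $\hat b^{\leftarrow}_{\bot,\bot,\bot}\circ(\hat w^{\leftarrow}_\bot\wedge\mathbf 1_\bot)\circ\hat w^{\leftarrow}_\bot=(\mathbf 1_\bot\wedge\hat w^{\leftarrow}_\bot)\circ\hat w^{\leftarrow}_\bot$; (4) an arrow $\kappa:\bot\to\top$ with $\check\delta^{\to}_\top=\check w^{\to}_\top\circ(\mathbf 1_\top\vee\kappa)$, $\check\sigma^{\to}_\top=\check w^{\to}_\top\circ(\kappa\vee\mathbf 1_\top)$, $\hat\delta^{\leftarrow}_\bot=(\mathbf 1_\bot\wedge\kappa)\circ\hat w^{\leftarrow}_\bot$, $\hat\sigma^{\leftarrow}_\bot=(\kappa\wedge\mathbf 1_\bot)\circ\hat w^{\leftarrow}_\bot$; (5) a natural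 transformation $c^k_{A,B,C,D}:(A\wedge B)\vee(C\wedge D)\to(A\vee C)\wedge(B\vee D)$ satisfying $$c^k_{A_1\vee A_2,A_1'\vee A_2',A_3,A_3'}\circ(c^k_{A_1,A_1',A_2,A_2'}\vee\mathbf 1_{A_3\wedge A_3'})\circ\check b^{\to}_{A_1\wedge A_1',A_2\wedge A_2',A_3\wedge A_3'}=(\check b^{\to}_{A_1,A_2,A_3}\wedge\check b^{\to}_{A_1',A_2',A_3'})\circ c^k_{A_1,A_1',A_2\vee A_3,A_2'\vee A_3'}\circ(\mathbf 1_{A_1\wedge A_1'}\vee c^k_{A_2,A_2',A_3,A_3'}),$$ $$\hat b^{\leftarrow}_{A_1\vee A_1',A_2\vee A_2',A_3\vee A_3'}\circ(c^k_{A_1,A_2,A_1',A_2'}\wedge\mathbf 1_{A_3\vee A_3'})\circ c^k_{A_1\wedge A_2,A_3,A_1'\wedge A_2',A_3'}=(\mathbf 1_{A_1\vee A_1'}\wedge c^k_{A_2,A_3,A_2',A_3'})\circ c^k_{A_1,A_2\wedge A_3,A_1',A_2'\wedge A_3'}\circ(\hat b^{\leftarrow}_{A_1,A_2,A_3}\vee\hat b^{\leftarrow}_{A_1',A_2',A_3'}),$$ $$\check\delta^{\to}_{A\wedge A'}=(\check\delta^{\to}_A\wedge\check\delta^{\to}_{A'})\circ c^k_{A,A',\bot,\bot}\circ(\mathbf 1_{A\wedge A'}\vee\hat w^{\leftarrow}_\bot),\quad \check\sigma^{\to}_{A\wedge A'}=(\check\sigma^{\to}_A\wedge\check\sigma^{\to}_{A'})\circ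 c^k_{\bot,\bot,A,A'}\circ(\hat w^{\leftarrow}_\bot\vee\mathbf 1_{A\wedge A'}),$$ $$\hat\delta^{\leftarrow}_{A\vee A'}=(\mathbf 1_{A\vee A'}\wedge\check w^{\to}_\top)\circ c^k_{A,\top,A',\top}\circ(\hat\delta^{\leftarrow}_A\vee\hat\delta^{\leftarrow}_{A'}),\quad \hat\sigma^{\leftarrow}_{A\vee A'}=(\check w^{\to}_\top\wedge\mathbf 1_{A\vee A'})\circ c^k_{\top,A,\top,A'}\circ(\hat\sigma^{\leftarrow}_A\vee\hat\sigma^{\leftarrow}_{A'}),$$ $$\hat\delta^{\to}_\top\circ(\check\delta^{\to}_\top\wedge\check\sigma^{\to}_\top)\circ c^k_{\top,\bot,\bot,\top}=\kappa\circ\check\delta^{\to}_\bot\circ(\hat\sigma^{\to}_\bot\vee\hat\delta^{\to}_\bot),\quad \hat\delta^{\to}_\top\circ(\check\sigma^{\to}_\top\wedge\check\delta^{\to}_\top)\circ c^k_{\bot,\top,\top,\bot}=\kappa\circ\check\delta^{\to}_\bot\circ(\hat\delta^{\to}_\bot\vee\hat\sigma^{\to}_\bot).$$ The free such category generated by a set of letters: objects are the formulae built from letters and the constants $\top,\bot$ by the binary connectives $\wedge,\vee$. Arrow terms are typed expressions generated from $\mathbf 1_A$ and all components (with formulae as indices) of the transformations and arrows above and their stated inverses, by composition $\circ$ (when types match) and the operations $\wedge,\vee$. Arrows are equivalence classes of arrow terms under the smallest equivalence relation, congruent with respect to $\circ,\wedge,\vee$, containing the category equations, functoriality of $\wedge,\vee$,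 naturality and isomorphism equations, and the equations listed above. Normal form $\nu(A)$ of a formula: $\nu(p)=p$ for a letter $p$; $\nu(\zeta)=\zeta$ for $\zeta\in\{\top,\bot\}$; $\nu(A_1\,\xi\, A_2)$ is $\zeta$ if $\nu(A_1)=\nu(A_2)=\zeta\in\{\top,\bot\}$; it is $\nu(A_i)$ if $\nu(A_{3-i})=\zeta\neq\nu(A_i)$ and $(\xi,\zeta)\in\{(\wedge,\top),(\vee,\bot)\}$, $i\in\{1,2\}$; otherwise it is $\nu(A_1)\,\xi\,\nu(A_2)$. A formula $A$ is pure when neither $\top$ nor $\bot$ occurs in $\nu(A)$. *)

(* Defs.v *)
Inductive conn : Type := And | Or.

(* [cst x] is the constant that is neutral for the connective [x]:
   [cst And] is ⊤ and [cst Or] is ⊥. *)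
Inductive formula (L : Type) : Type :=
| letter (p : L)
| cst (x : conn)
| bin (x : conn) (A B : formula L).

Arguments letter {L} p.
Arguments cst {L} x.
Arguments bin {L} x A B.

Declare Scope formula_scope.
Delimit Scope formula_scope with form.
Bind Scope formula_scope with formula.

Notation "⊤" := (cst And) (at level 0) : formula_scope.
Notation "⊥" := (cst Or) (at level 0) : formula_scope.
Notation "A ∧ B" := (bin And A B) (at level 80, right associativity) : formula_scope.
Notation "A ∨ B" := (bin Or A B) (at level 85, right associativity) : formula_scope.

(* Arrow terms, typed by their source and target.  The components with a
   [conn] argument give the hatted family at [And] and the checked family at
   [Or].  Suffixes [_to] and [_from] stand for the superscripts → and ←. *)
Inductive term (L : Type) : formula L -> formula L -> Type :=
| idt (A : formula L) : term L A A
| comp (A B C : formula L) (g : term L B C) (f : term L A B) : term L A C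
| par (x : conn) (A B A' B' : formula L) (f : term L A B) (g : term L A' B') :
    term L (bin x A A') (bin x B B')
| b_to (x : conn) (A B C : formula L) :
    term L (bin x A (bin x B C)) (bin x (bin x A B) C)
| b_from (x : conn) (A B C : formula L) :
    term L (bin x (bin x A B) C) (bin x A (bin x B C))
| delta_to (x : conn) (A : formula L) : term L (bin x A (cst x)) A
| delta_from (x : conn) (A : formula L) : term L A (bin x A (cst x))
| sigma_to (x : conn) (A : formula L) : term L (bin x (cst x) A) A
| sigma_from (x : conn) (A : formula L) : term L A (bin x (cst x) A)
| wbot_to : term L (⊥ ∧ ⊥) ⊥
| wbot_from : term L ⊥ (⊥ ∧ ⊥)
| wtop_to : term L (⊤ ∨ ⊤) ⊤
| wtop_from : term L ⊤ (⊤ ∨ ⊤)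
| kappa : term L ⊥ ⊤
| ck (A B C D : formula L) :
    term L ((A ∧ B) ∨ (C ∧ D)) ((A ∨ C) ∧ (B ∨ D)).

Arguments term {L} A%_form B%_form.
Arguments idt {L} A%_form.
Arguments comp {L A B C} g f.
Arguments par {L} x {A B A' B'} f g.
Arguments b_to {L} x (A B C)%_form.
Arguments b_from {L} x (A B C)%_form.
Arguments delta_to {L} x A%_form.
Arguments delta_from {L} x A%_form.
Arguments sigma_to {L} x A%_form.
Arguments sigma_from {L} x A%_form.
Arguments wbot_to {L}.
Arguments wbot_from {L}.
Arguments wtop_to {L}.
Arguments wtop_from {L}.
Arguments kappa {L}.
Arguments ck {L} (A B C D)%_form.

Declare Scope term_scope.
Delimit Scope term_scope with term.
Bind Scope term_scope with term.

Notation "g ∘ f" := (comp g f) (at level 40, left associativity) : term_scope.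
Notation "f ∧ g" := (par And f g) (at level 80, right associativity) : term_scope.
Notation "f ∨ g" := (par Or f g) (at level 85, right associativity) : term_scope.

Reserved Notation "f ≡ g" (at level 70, no associativity).

(* Equality of arrows in the free bimonoidal intermuting category on [L]: its
   arrows A → B are the elements of [term A B] taken up to [≡].  Naturality of
   the inverse components is derivable and therefore not listed. *)
Inductive eqv (L : Type) :
    forall A B : formula L, term A B -> term A B -> Prop :=
| eqv_refl A B (f : term A B) : f ≡ f
| eqv_sym A B (f g : term A B) : f ≡ g -> g ≡ f
| eqv_trans A B (f g h : term A B) : f ≡ g -> g ≡ h -> f ≡ h
| eqv_comp A B C (g g' : term B C) (f f' : term A B) :
    g ≡ g' -> f ≡ f' -> g ∘ f ≡ g' ∘ f'
| eqv_par x A B A' B' (f f' : term A B) (g g' : term A' B') :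
    f ≡ f' -> g ≡ g' -> par x f g ≡ par x f' g'

| eqv_id_l A B (f : term A B) : idt B ∘ f ≡ f
| eqv_id_r A B (f : term A B) : f ∘ idt A ≡ f
| eqv_assoc A B C D (h : term C D) (g : term B C) (f : term A B) :
    h ∘ (g ∘ f) ≡ (h ∘ g) ∘ f

| eqv_par_id x A B : par x (idt A) (idt B) ≡ idt (bin x A B)
| eqv_par_comp x A B C A' B' C'
    (g : term B C) (f : term A B) (g' : term B' C') (f' : term A' B') :
    par x (g ∘ f) (g' ∘ f') ≡ par x g g' ∘ par x f f'

| eqv_b_nat x A B C A' B' C'
    (f : term A A') (g : term B B') (h : term C C') :
    par x (par x f g) h ∘ b_to x A B C ≡ b_to x A' B' C' ∘ par x f (par x g h)
| eqv_b_to_from x A B C :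
    b_to x A B C ∘ b_from x A B C ≡ idt (bin x (bin x A B) C)
| eqv_b_from_to x A B C :
    b_from x A B C ∘ b_to x A B C ≡ idt (bin x A (bin x B C))
| eqv_b_pentagon x A B C D :
    b_to x (bin x A B) C D ∘ b_to x A B (bin x C D)
    ≡ par x (b_to x A B C) (idt D) ∘ b_to x A (bin x B C) D
        ∘ par x (idt A) (b_to x B C D)

| eqv_delta_nat x A A' (f : term A A') :
    f ∘ delta_to x A ≡ delta_to x A' ∘ par x f (idt (cst x))
| eqv_delta_to_from x A : delta_to x A ∘ delta_from x A ≡ idt A
| eqv_delta_from_to x A :
    delta_from x A ∘ delta_to x A ≡ idt (bin x A (cst x))
| eqv_sigma_nat x A A' (f : term A A') :
    f ∘ sigma_to x A ≡ sigma_to x A' ∘ par x (idt (cst x)) f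
| eqv_sigma_to_from x A : sigma_to x A ∘ sigma_from x A ≡ idt A
| eqv_sigma_from_to x A :
    sigma_from x A ∘ sigma_to x A ≡ idt (bin x (cst x) A)
| eqv_delta_sigma x : delta_to x (cst x) ≡ sigma_to x (cst x)
| eqv_b_unit x A C :
    b_to x A (cst x) C ≡ par x (delta_from x A) (sigma_to x C)

| eqv_wbot_to_from : wbot_to ∘ wbot_from ≡ idt ⊥
| eqv_wbot_from_to : wbot_from ∘ wbot_to ≡ idt (⊥ ∧ ⊥)
| eqv_wtop_to_from : wtop_to ∘ wtop_from ≡ idt ⊤
| eqv_wtop_from_to : wtop_from ∘ wtop_to ≡ idt (⊤ ∨ ⊤)
| eqv_wtop_assoc :
    wtop_to ∘ (wtop_to ∨ idt ⊤) ∘ b_to Or ⊤ ⊤ ⊤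
    ≡ wtop_to ∘ (idt ⊤ ∨ wtop_to)
| eqv_wbot_assoc :
    b_from And ⊥ ⊥ ⊥ ∘ (wbot_from ∧ idt ⊥) ∘ wbot_from
    ≡ (idt ⊥ ∧ wbot_from) ∘ wbot_from

| eqv_kappa_top_r : delta_to Or ⊤ ≡ wtop_to ∘ (idt ⊤ ∨ kappa)
| eqv_kappa_top_l : sigma_to Or ⊤ ≡ wtop_to ∘ (kappa ∨ idt ⊤)
| eqv_kappa_bot_r : delta_from And ⊥ ≡ (idt ⊥ ∧ kappa) ∘ wbot_from
| eqv_kappa_bot_l : sigma_from And ⊥ ≡ (kappa ∧ idt ⊥) ∘ wbot_from

| eqv_ck_nat A B C D A' B' C' D'
    (f : term A A') (g : term B B') (h : term C C') (k : term D D') :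
    ((f ∨ h) ∧ (g ∨ k)) ∘ ck A B C D ≡ ck A' B' C' D' ∘ ((f ∧ g) ∨ (h ∧ k))
| eqv_ck_b_or A1 A2 A3 A1' A2' A3' :
    ck (A1 ∨ A2) (A1' ∨ A2') A3 A3' ∘ (ck A1 A1' A2 A2' ∨ idt (A3 ∧ A3'))
      ∘ b_to Or (A1 ∧ A1') (A2 ∧ A2') (A3 ∧ A3')
    ≡ (b_to Or A1 A2 A3 ∧ b_to Or A1' A2' A3')
      ∘ ck A1 A1' (A2 ∨ A3) (A2' ∨ A3')
      ∘ (idt (A1 ∧ A1') ∨ ck A2 A2' A3 A3')
| eqv_ck_b_and A1 A2 A3 A1' A2' A3' :
    b_from And (A1 ∨ A1') (A2 ∨ A2') (A3 ∨ A3')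
      ∘ (ck A1 A2 A1' A2' ∧ idt (A3 ∨ A3'))
      ∘ ck (A1 ∧ A2) A3 (A1' ∧ A2') A3'
    ≡ (idt (A1 ∨ A1') ∧ ck A2 A3 A2' A3')
      ∘ ck A1 (A2 ∧ A3) A1' (A2' ∧ A3')
      ∘ (b_from And A1 A2 A3 ∨ b_from And A1' A2' A3')
| eqv_ck_delta_or A A' :
    delta_to Or (A ∧ A')
    ≡ (delta_to Or A ∧ delta_to Or A') ∘ ck A A' ⊥ ⊥
      ∘ (idt (A ∧ A') ∨ wbot_from)
| eqv_ck_sigma_or A A' :
    sigma_to Or (A ∧ A')
    ≡ (sigma_to Or A ∧ sigma_to Or A') ∘ ck ⊥ ⊥ A A'
      ∘ (wbot_from ∨ idt (A ∧ A'))
| eqv_ck_delta_and A A' :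
    delta_from And (A ∨ A')
    ≡ (idt (A ∨ A') ∧ wtop_to) ∘ ck A ⊤ A' ⊤
      ∘ (delta_from And A ∨ delta_from And A')
| eqv_ck_sigma_and A A' :
    sigma_from And (A ∨ A')
    ≡ (wtop_to ∧ idt (A ∨ A')) ∘ ck ⊤ A ⊤ A'
      ∘ (sigma_from And A ∨ sigma_from And A')
| eqv_ck_kappa_1 :
    delta_to And ⊤ ∘ (delta_to Or ⊤ ∧ sigma_to Or ⊤) ∘ ck ⊤ ⊥ ⊥ ⊤
    ≡ kappa ∘ delta_to Or ⊥ ∘ (sigma_to And ⊥ ∨ delta_to And ⊥)
| eqv_ck_kappa_2 :
    delta_to And ⊤ ∘ (sigma_to Or ⊤ ∧ delta_to Or ⊤) ∘ ck ⊥ ⊤ ⊤ ⊥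
    ≡ kappa ∘ delta_to Or ⊥ ∘ (delta_to And ⊥ ∨ sigma_to And ⊥)

where "f ≡ g" := (eqv _ _ _ f%term g%term).

Arguments eqv {L A B} f%_term g%_term.
Notation "f ≡ g" := (eqv f g) : type_scope.

Definition is_unit {L : Type} (x : conn) (A : formula L) : bool :=
  match x, A with
  | And, ⊤%form | Or, ⊥%form => true
  | _, _ => false
  end.

Definition nu_bin {L : Type} (x : conn) (N1 N2 : formula L) : formula L :=
  if (is_unit And N1 && is_unit And N2)%bool then ⊤%form
  else if (is_unit Or N1 && is_unit Or N2)%bool then ⊥%form
  else if is_unit x N2 then N1
  else if is_unit x N1 then N2
  else bin x N1 N2.

Fixpoint nu {L : Type} (A : formula L) : formula L :=
  match A with
  | bin x A1 A2 => nu_bin x (nu A1) (nu A2)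
  | _ => A
  end.

(* [S] is meant to be atomic: a letter or a constant. *)
Fixpoint occurs {L : Type} (S A : formula L) : Prop :=
  match A with
  | bin _ A1 A2 => occurs S A1 \/ occurs S A2
  | _ => A = S
  end.

Definition pure {L : Type} (A : formula L) : Prop :=
  ~ occurs ⊤ (nu A) /\ ~ occurs ⊥ (nu A).

Definition letterless {L : Type} (A : formula L) : Prop :=
  forall p : L, ~ occurs (letter p) A.

(* Main.v *)
Require Import Defs.
From Stdlib Require Import Setoid Morphisms List Permutation Lia Arith Bool
  ProofIrrelevance.
Import ListNotations.

(* Order the possible shapes of normal forms so that arrows are monotone; then all
   formulae between two pure ones are pure.  Hence, up to the canonical
   isomorphisms with normal forms, every arrow between pure formulae is unit-free,
   and every arrow between letterless formulae is an identity or κ.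

   A unit-free arrow into B1 ∧ B2 or B1 ∨ B2 factors through a canonical splitting
   A -> A1 ξ A2 followed by a componentwise arrow.  By induction on the target, two
   arrows A -> B are equal once the splittings they induce are, that is, once they
   match the letter occurrences of A and B in the same way.  This matching f is
   unique, even when letters are repeated: it sends maximal ∧-cliques of A to
   maximal ∧-cliques of B, and f^-1 sends maximal ∨-cliques to maximal ∨-cliques.
   Determine it from left to right along A.  If two matchings agree before an
   occurrence a, they send a maximal ∧-clique through a to maximal ∧-cliques of B
   that coincide up to the image of a; if the images b, b' of a differ, then b and
   b' are joined by ∨ in B, say b before b'.  Then the occurrence sent to b by the second matching lies
   before a, and by agreement the first one also sends it to b, a contradiction. *)

(** * Equational consequences of the axioms *)

Local Open Scope term_scope.

#[local] Hint Resolve eqv_refl : core.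

#[global] Instance eqv_equivalence {L} (A B : formula L) :
  Equivalence (@eqv L A B).
Proof.
  split; red; intros; eauto using eqv_sym, eqv_trans.
Qed.

#[global] Instance comp_proper {L} (A B C : formula L) :
  Proper (eqv ==> eqv ==> eqv) (@comp L A B C).
Proof. repeat red; intros; now apply eqv_comp. Qed.

#[global] Instance par_proper {L} x (A B A' B' : formula L) :
  Proper (eqv ==> eqv ==> eqv) (@par L x A B A' B').
Proof. repeat red; intros; now apply eqv_par. Qed.

Lemma comp_assoc {L} {A B C D : formula L}
    (h : term C D) (g : term B C) (f : term A B) :
  (h ∘ g) ∘ f ≡ h ∘ (g ∘ f).
Proof. symmetry; apply eqv_assoc. Qed.

Lemma comp_par {L} x {A B C A' B' C' : formula L}
    (g : term B C) (f : term A B) (g' : term B' C') (f' : term A' B') :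
  par x g g' ∘ par x f f' ≡ par x (g ∘ f) (g' ∘ f').
Proof. symmetry; apply eqv_par_comp. Qed.

Lemma precomp {L} {A B B' C D : formula L} (a : term B C) (b : term A B)
    (c : term B' C) (d : term A B') :
  a ∘ b ≡ c ∘ d -> forall k : term D A, a ∘ (b ∘ k) ≡ c ∘ (d ∘ k).
Proof. intros H k. now rewrite !eqv_assoc, H. Qed.

Lemma precomp1 {L} {A B C D : formula L} (a : term B C) (b : term A B)
    (c : term A C) :
  a ∘ b ≡ c -> forall k : term D A, a ∘ (b ∘ k) ≡ c ∘ k.
Proof. intros H k. now rewrite eqv_assoc, H. Qed.

Lemma epi_of_section {L} {A B C : formula L} (f : term A B) (s : term B A)
    (g h : term B C) :
  f ∘ s ≡ idt B -> g ∘ f ≡ h ∘ f -> g ≡ h.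
Proof.
  intros fs E. rewrite <- (eqv_id_r _ _ _ g), <- (eqv_id_r _ _ _ h), <- fs.
  now rewrite !eqv_assoc, E.
Qed.

Lemma mono_of_retraction {L} {A B C : formula L} (f : term B C) (r : term C B)
    (g h : term A B) :
  r ∘ f ≡ idt B -> f ∘ g ≡ f ∘ h -> g ≡ h.
Proof.
  intros rf E. rewrite <- (eqv_id_l _ _ _ g), <- (eqv_id_l _ _ _ h), <- rf.
  now rewrite !comp_assoc, E.
Qed.

(** Turns a commuting square around along the inverses of two opposite sides; laws for [_from]
    components come this way from those for their [_to] counterparts. *)
Lemma inverse_square {L} {A A' B B' : formula L}
    (u : term A B) (u' : term B A) (v : term A' B') (v' : term B' A')
    (f : term A A') (g : term B B') :
  u ∘ u' ≡ idt B -> v' ∘ v ≡ idt A' -> v ∘ f ≡ g ∘ u -> f ∘ u' ≡ v' ∘ g.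
Proof.
  intros uu vv E.
  rewrite <- (eqv_id_l _ _ _ f), <- vv, !comp_assoc, (precomp _ _ _ _ E), uu.
  now rewrite eqv_id_r.
Qed.

Lemma par_inverse {L} x {A B A' B' : formula L}
    (f : term A B) (g : term B A) (f' : term A' B') (g' : term B' A') :
  g ∘ f ≡ idt A -> g' ∘ f' ≡ idt A' -> par x g g' ∘ par x f f' ≡ idt (bin x A A').
Proof. intros E E'. now rewrite comp_par, E, E', eqv_par_id. Qed.

Lemma par_compl {L} x {A B C A' B' : formula L}
    (g : term B C) (f : term A B) (f' : term A' B') :
  par x (g ∘ f) f' ≡ par x g (idt B') ∘ par x f f'.
Proof. now rewrite comp_par, eqv_id_l. Qed.

Lemma par_compr {L} x {A B A' B' C' : formula L}
    (f : term A B) (g' : term B' C') (f' : term A' B') :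
  par x f (g' ∘ f') ≡ par x (idt B) g' ∘ par x f f'.
Proof. now rewrite comp_par, eqv_id_l. Qed.

Lemma b_from_nat {L} x {A B C A' B' C' : formula L}
    (f : term A A') (g : term B B') (h : term C C') :
  par x f (par x g h) ∘ b_from x A B C ≡ b_from x A' B' C' ∘ par x (par x f g) h.
Proof.
  apply (inverse_square (b_to x A B C) _ (b_to x A' B' C'));
    [apply eqv_b_to_from | apply eqv_b_from_to | symmetry; apply eqv_b_nat].
Qed.

(** This and [pentagon_mid] are the pentagon with some sides inverted, in the forms met when a cut
    inside the first or the second factor passes an associativity. *)
Lemma pentagon_left {L} x (A B C D : formula L) :
  b_from x A (bin x B C) D ∘ par x (b_from x A B C) (idt D) ∘ b_to x (bin x A B) C D
  ≡ par x (idt A) (b_to x B C D) ∘ b_from x A B (bin x C D).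
Proof.
  symmetry. apply (inverse_square (b_to x A B (bin x C D)) _
    (par x (b_to x A B C) (idt D) ∘ b_to x A (bin x B C) D)).
  - apply eqv_b_to_from.
  - rewrite !comp_assoc, (precomp1 _ _ _ (par_inverse x _ _ _ _
      (eqv_b_from_to _ x A B C) (eqv_id_l _ _ _ (idt D)))), eqv_id_l.
    apply eqv_b_from_to.
  - symmetry; apply eqv_b_pentagon.
Qed.

Lemma pentagon_mid {L} x (A B C D : formula L) :
  b_from x (bin x A B) C D ∘ par x (b_to x A B C) (idt D) ∘ b_to x A (bin x B C) D
  ≡ b_to x A B (bin x C D) ∘ par x (idt A) (b_from x B C D).
Proof.
  rewrite comp_assoc. symmetry.
  apply (inverse_square (par x (idt A) (b_to x B C D)) _ (b_to x (bin x A B) C D)).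
  - apply par_inverse; [apply eqv_id_l | apply eqv_b_to_from].
  - apply eqv_b_from_to.
  - apply eqv_b_pentagon.
Qed.

Lemma sigma_faithful {L} x {A B : formula L} (f g : term A B) :
  par x (idt (cst x)) f ≡ par x (idt (cst x)) g -> f ≡ g.
Proof.
  intros E. apply (epi_of_section (sigma_to x A) (sigma_from x A));
    [apply eqv_sigma_to_from|].
  now rewrite !eqv_sigma_nat, E.
Qed.

Lemma delta_faithful {L} x {A B : formula L} (f g : term A B) :
  par x f (idt (cst x)) ≡ par x g (idt (cst x)) -> f ≡ g.
Proof.
  intros E. apply (epi_of_section (delta_to x A) (delta_from x A));
    [apply eqv_delta_to_from|].
  now rewrite !eqv_delta_nat, E.
Qed.

Lemma triangle {L} x (A B : formula L) :
  par x (delta_to x A) (idt B) ∘ b_to x A (cst x) B ≡ par x (idt A) (sigma_to x B).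
Proof. now rewrite eqv_b_unit, comp_par, eqv_delta_to_from, eqv_id_l. Qed.

(** Kelly's argument: after joining a unit on the left, which is faithful, the equation follows from
    the pentagon and two triangles. Joining it on the right gives [delta_to_bin]. *)
Lemma sigma_to_bin {L} x (A B : formula L) :
  par x (sigma_to x A) (idt B) ∘ b_to x (cst x) A B ≡ sigma_to x (bin x A B).
Proof.
  apply (sigma_faithful x), (mono_of_retraction (b_to x (cst x) A B)
    (b_from x (cst x) A B)); [apply eqv_b_from_to|].
  rewrite <- triangle, par_compr, eqv_assoc, <- eqv_b_nat.
  rewrite <- (triangle x (cst x) A), par_compl.
  rewrite !comp_assoc, (eqv_assoc _ _ _ _ _ (par x (b_to x (cst x) _ A) _)).
  rewrite <- eqv_b_pentagon.
  now rewrite eqv_assoc, eqv_b_nat, eqv_par_id, comp_assoc.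
Qed.

Lemma delta_to_bin {L} x (A B : formula L) :
  delta_to x (bin x A B) ∘ b_to x A B (cst x) ≡ par x (idt A) (delta_to x B).
Proof.
  apply (delta_faithful x).
  apply (epi_of_section (b_to x A (bin x B (cst x)) (cst x)) (b_from _ _ _ _));
    [apply eqv_b_to_from|].
  apply (epi_of_section (par x (idt A) (b_to x B (cst x) (cst x)))
    (par x (idt A) (b_from x B (cst x) (cst x))));
    [apply par_inverse; [apply eqv_id_l | apply eqv_b_to_from]|].
  rewrite eqv_b_nat, par_compl, !comp_assoc, comp_par, eqv_id_l, triangle.
  rewrite (eqv_assoc _ _ _ _ _ (par x (b_to x A B (cst x)) _)).
  rewrite <- eqv_b_pentagon, eqv_assoc, triangle, <- eqv_b_nat.
  now rewrite eqv_par_id.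
Qed.

(** * Unit-free arrows and splittings *)

(* Arrow terms without unit isomorphisms; the constants behave as further atoms
   here, except for κ, which is needed to treat letterless formulae uniformly. *)
Inductive uterm (L : Type) : formula L -> formula L -> Type :=
| u_id A : uterm L A A
| u_comp A B C (g : uterm L B C) (f : uterm L A B) : uterm L A C
| u_par x A B A' B' (f : uterm L A B) (g : uterm L A' B') :
    uterm L (bin x A A') (bin x B B')
| u_b_to x A B C : uterm L (bin x A (bin x B C)) (bin x (bin x A B) C)
| u_b_from x A B C : uterm L (bin x (bin x A B) C) (bin x A (bin x B C))
| u_kappa : uterm L ⊥ ⊤
| u_ck A B C D : uterm L ((A ∧ B) ∨ (C ∧ D)) ((A ∨ C) ∧ (B ∨ D)).

Arguments uterm {L} A%_form B%_form.
Arguments u_id {L} A%_form.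
Arguments u_comp {L A B C} g f.
Arguments u_par {L} x {A B A' B'} f g.
Arguments u_b_to {L} x (A B C)%_form.
Arguments u_b_from {L} x (A B C)%_form.
Arguments u_kappa {L}.
Arguments u_ck {L} (A B C D)%_form.

Fixpoint em {L} {A B : formula L} (f : uterm A B) : term A B :=
  match f with
  | u_id A => idt A
  | u_comp g f => em g ∘ em f
  | u_par x f g => par x (em f) (em g)
  | u_b_to x A B C => b_to x A B C
  | u_b_from x A B C => b_from x A B C
  | u_kappa => kappa
  | u_ck A B C D => ck A B C D
  end.

(* [deco K A] is the type of labellings of the letter occurrences of [A] in [K]. *)
Fixpoint deco {L} (K : Type) (A : formula L) : Type :=
  match A with
  | letter _ => K
  | cst _ => unit
  | bin _ A B => deco K A * deco K B
  end.

(** Pulls labels back along the matching of letter occurrences that [f] induces. Distinct labels on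
    the target determine this matching, so occurrences need no names of their own. *)
Fixpoint trb {L K} {A B : formula L} (f : uterm A B) : deco K B -> deco K A :=
  match f with
  | u_id A => fun b => b
  | u_comp g f => fun c => trb f (trb g c)
  | u_par x f g => fun b => (trb f (fst b), trb g (snd b))
  | u_b_to x A B C => fun b => (fst (fst b), (snd (fst b), snd b))
  | u_b_from x A B C => fun b => ((fst b, fst (snd b)), snd (snd b))
  | u_kappa => fun b => b
  | u_ck A B C D => fun b =>
      ((fst (fst b), fst (snd b)), (snd (fst b), snd (snd b)))
  end.

Inductive root := Root.

(* A code selects a canonical way of splitting [A] along [x]: cutting a string of
   [x]-factors at some place, possibly inside a factor, or, at [And], splitting
   both sides of a disjunction, which is where [ck] comes in. *)
Fixpoint code {L} (x : conn) (A : formula L) : Type :=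
  match A with
  | bin y A B =>
      match x, y with
      | And, And | Or, Or => root + (code x A + code x B)
      | And, Or => code x A * code x B
      | Or, And => Empty_set
      end
  | _ => Empty_set
  end.

(** [merge] plays for [sarr] the part that [trb] plays for unit-free terms. *)
Record splitting {L} (x : conn) (A : formula L) := Splitting {
  lft : formula L;
  rgt : formula L;
  sarr : term A (bin x lft rgt);
  merge : forall K, deco K lft -> deco K rgt -> deco K A
}.

Arguments Splitting {L x A}.
Arguments lft {L x A}.
Arguments rgt {L x A}.
Arguments sarr {L x A}.
Arguments merge {L x A} _ {K}.

Definition split_root {L} x (A B : formula L) : splitting x (bin x A B) :=
  Splitting A B (idt _) (fun K u v => (u, v)).

Definition split_left {L} x {A} (B : formula L) (s : splitting x A) :
    splitting x (bin x A B) :=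
  Splitting (lft s) (bin x (rgt s) B) (b_from x _ _ _ ∘ par x (sarr s) (idt B))
    (fun K u v => (merge s u (fst v), snd v)).

Definition split_right {L} x (A : formula L) {B} (s : splitting x B) :
    splitting x (bin x A B) :=
  Splitting (bin x A (lft s)) (rgt s) (b_to x _ _ _ ∘ par x (idt A) (sarr s))
    (fun K u v => (fst u, merge s (snd u) v)).

Definition split_both {L} {A B : formula L}
    (s : splitting And A) (t : splitting And B) : splitting And (A ∨ B) :=
  Splitting (lft s ∨ lft t)%form (rgt s ∨ rgt t)%form
    (ck _ _ _ _ ∘ (sarr s ∨ sarr t))
    (fun K u v => (merge s (fst u) (fst v), merge t (snd u) (snd v))).

Definition split_same {L} x {A B : formula L} (sA : code x A -> splitting x A)
    (sB : code x B -> splitting x B) (c : root + (code x A + code x B)) :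
    splitting x (bin x A B) :=
  match c with
  | inl _ => split_root x A B
  | inr (inl c) => split_left x B (sA c)
  | inr (inr c) => split_right x A (sB c)
  end.

Fixpoint split_at {L} x (A : formula L) : code x A -> splitting x A :=
  match A with
  | bin y A B =>
      match x, y return (code x A -> splitting x A) ->
        (code x B -> splitting x B) -> code x (bin y A B) -> splitting x (bin y A B)
      with
      | And, And => split_same And
      | Or, Or => split_same Or
      | And, Or => fun sA sB c => split_both (sA (fst c)) (sB (snd c))
      | Or, And => fun sA sB c => match c with end
      end (split_at x A) (split_at x B)
  | _ => fun c => match c with end
  end.

(** The last clause repeats the square on labellings, from which the position of the source cut is
    later read off. *)
Definition factors {L} {A B : formula L} (f : uterm A B) {x}
    (s : splitting x B) (t : splitting x A) : Prop :=
  exists (f' : uterm (lft t) (lft s)) (f'' : uterm (rgt t) (rgt s)),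
    sarr s ∘ em f ≡ par x (em f') (em f'') ∘ sarr t /\
    forall K (u : deco K (lft s)) (v : deco K (rgt s)),
      trb f (merge s u v) = merge t (trb f' u) (trb f'' v).

Lemma factors_par_root {L} x {A B A' B' : formula L}
    (f : uterm A B) (g : uterm A' B') :
  factors (u_par x f g) (split_root x B B') (split_root x A A').
Proof.
  exists f, g; simpl; split; [|easy]. now rewrite eqv_id_l, eqv_id_r.
Qed.

Lemma factors_par_left {L} x {A B A' B' : formula L}
    (f : uterm A B) (g : uterm A' B') s t :
  factors f s t -> factors (u_par x f g) (split_left x B' s) (split_left x A' t).
Proof.
  intros (f' & f'' & E & M). exists f', (u_par x f'' g); simpl; split.
  - rewrite eqv_assoc, b_from_nat, !comp_assoc, !comp_par, E.
    now rewrite eqv_id_l, eqv_id_r.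
  - intros. now rewrite M.
Qed.

Lemma factors_par_right {L} x {A B A' B' : formula L}
    (f : uterm A B) (g : uterm A' B') s t :
  factors g s t -> factors (u_par x f g) (split_right x B s) (split_right x A t).
Proof.
  intros (f' & f'' & E & M). exists (u_par x f f'), f''; simpl; split.
  - rewrite eqv_assoc, eqv_b_nat, !comp_assoc, !comp_par, E.
    now rewrite eqv_id_l, eqv_id_r.
  - intros. now rewrite M.
Qed.

Lemma factors_par_both {L} {A B A' B' : formula L}
    (f : uterm A B) (g : uterm A' B') s s' t t' :
  factors f s t -> factors g s' t' ->
  factors (u_par Or f g) (split_both s s') (split_both t t').
Proof.
  intros (f' & f'' & E & M) (g' & g'' & E' & M').
  exists (u_par Or f' g'), (u_par Or f'' g''); simpl; split.
  - rewrite eqv_assoc, eqv_ck_nat, !comp_assoc, !comp_par. now rewrite E, E'.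
  - intros. now rewrite M, M'.
Qed.

Lemma factors_comp {L} {A B C : formula L} (g : uterm B C) (f : uterm A B) x
    (r : splitting x C) s t :
  factors g r s -> factors f s t -> factors (u_comp g f) r t.
Proof.
  intros (g' & g'' & E & M) (f' & f'' & E' & M').
  exists (u_comp g' f'), (u_comp g'' f''); simpl; split.
  - rewrite eqv_assoc, E, comp_assoc, E'. now rewrite eqv_assoc, comp_par.
  - intros. now rewrite M, M'.
Qed.

(** Associativity and its inverse carry corresponding cuts to each other, so one square settles both
    directions. *)
Definition factors2 {L} {A B : formula L} (f : uterm A B) (g : uterm B A) {x}
    (s : splitting x B) (t : splitting x A) : Prop :=
  factors f s t /\ factors g t s.

Lemma factors2_intro {L} {A B : formula L} (f : uterm A B) (g : uterm B A) {x}
    (s : splitting x B) (t : splitting x A)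
    (f' : uterm (lft t) (lft s)) (f'' : uterm (rgt t) (rgt s))
    (g' : uterm (lft s) (lft t)) (g'' : uterm (rgt s) (rgt t)) :
  em f ∘ em g ≡ idt B -> em g' ∘ em f' ≡ idt _ -> em g'' ∘ em f'' ≡ idt _ ->
  sarr s ∘ em f ≡ par x (em f') (em f'') ∘ sarr t ->
  (forall K (u : deco K (lft s)) (v : deco K (rgt s)),
      trb f (merge s u v) = merge t (trb f' u) (trb f'' v)) ->
  (forall K (u : deco K (lft t)) (v : deco K (rgt t)),
      trb g (merge t u v) = merge s (trb g' u) (trb g'' v)) ->
  factors2 f g s t.
Proof.
  intros I I' I'' E M M'. split.
  - now exists f', f''.
  - exists g', g''; split; [|easy].
    apply (inverse_square (em f) _ (par x (em f') (em f''))); [easy| |now symmetry].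
    now apply par_inverse.
Qed.

Lemma factors_b_root {L} x (A B C : formula L) :
  factors2 (u_b_to x A B C) (u_b_from x A B C)
    (split_root x (bin x A B) C) (split_right x A (split_root x B C)).
Proof.
  unshelve eapply factors2_intro;
    [exact (u_id _) | exact (u_id _) | exact (u_id _) | exact (u_id _) | ..];
    simpl; rewrite ?eqv_par_id, ?eqv_id_l, ?eqv_id_r; try easy.
  - apply eqv_b_to_from.
  - now intros K [u u'] v.
Qed.

Lemma factors_b_left_root {L} x (A B C : formula L) :
  factors2 (u_b_to x A B C) (u_b_from x A B C)
    (split_left x C (split_root x A B)) (split_root x A (bin x B C)).
Proof.
  unshelve eapply factors2_intro;
    [exact (u_id _) | exact (u_id _) | exact (u_id _) | exact (u_id _) | ..];
    simpl; rewrite ?eqv_par_id, ?eqv_id_l, ?eqv_id_r; try easy.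
  - apply eqv_b_to_from.
  - apply eqv_b_from_to.
  - now intros K u [v v'].
Qed.

Lemma factors_b_left_left {L} x (A B C : formula L) (s : splitting x A) :
  factors2 (u_b_to x A B C) (u_b_from x A B C)
    (split_left x C (split_left x B s)) (split_left x (bin x B C) s).
Proof.
  unshelve eapply factors2_intro;
    [exact (u_id _) | exact (u_b_to x _ _ _) | exact (u_id _) | exact (u_b_from x _ _ _) | ..];
    simpl; try easy.
  - apply eqv_b_to_from.
  - apply eqv_id_l.
  - apply eqv_b_from_to.
  - rewrite par_compl, !comp_assoc, eqv_b_nat, eqv_par_id.
    rewrite (eqv_assoc _ _ _ _ _ (b_from _ _ _ _)), (eqv_assoc _ _ _ _ _ (_ ∘ _)).
    now rewrite pentagon_left, comp_assoc.
Qed.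

Lemma factors_b_left_right {L} x (A B C : formula L) (s : splitting x B) :
  factors2 (u_b_to x A B C) (u_b_from x A B C)
    (split_left x C (split_right x A s)) (split_right x A (split_left x C s)).
Proof.
  unshelve eapply factors2_intro;
    [exact (u_id _) | exact (u_id _) | exact (u_id _) | exact (u_id _) | ..];
    simpl; try easy; try apply eqv_id_l.
  - apply eqv_b_to_from.
  - rewrite eqv_par_id, eqv_id_l, par_compl, par_compr, !comp_assoc, eqv_b_nat.
    rewrite (eqv_assoc _ _ _ _ _ (b_from _ _ _ _)), (eqv_assoc _ _ _ _ _ (_ ∘ _)).
    now rewrite pentagon_mid, comp_assoc.
Qed.

Lemma factors_b_right {L} x (A B C : formula L) (s : splitting x C) :
  factors2 (u_b_to x A B C) (u_b_from x A B C)
    (split_right x (bin x A B) s) (split_right x A (split_right x B s)).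
Proof.
  unshelve eapply factors2_intro;
    [exact (u_b_to x _ _ _) | exact (u_id _) | exact (u_b_from x _ _ _) | exact (u_id _) | ..];
    simpl; try easy.
  - apply eqv_b_to_from.
  - apply eqv_b_from_to.
  - apply eqv_id_l.
  - rewrite <- eqv_par_id, par_compr, !comp_assoc, eqv_b_nat.
    rewrite eqv_assoc, eqv_b_pentagon. now rewrite !comp_assoc.
Qed.

(** This is the axiom [eqv_ck_b_or], up to naturality. *)
Lemma factors_b_both {L} (A B C : formula L)
    (s : splitting And A) (t : splitting And B) (r : splitting And C) :
  factors2 (u_b_to Or A B C) (u_b_from Or A B C)
    (split_both (split_both s t) r) (split_both s (split_both t r)).
Proof.
  unshelve eapply factors2_intro;
    [exact (u_b_to Or _ _ _) | exact (u_b_to Or _ _ _) | exact (u_b_from Or _ _ _) | exact (u_b_from Or _ _ _) | ..];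
    simpl; try easy;
    try apply eqv_b_to_from; try apply eqv_b_from_to.
  rewrite par_compl, par_compr, !comp_assoc, eqv_b_nat.
  rewrite (eqv_assoc _ _ _ _ _ (ck _ _ _ _)), (eqv_assoc _ _ _ _ _ (_ ∘ _)).
  rewrite eqv_ck_b_or. now rewrite !comp_assoc.
Qed.

Lemma factors_ck_root {L} (A B C D : formula L) :
  factors (u_ck A B C D) (split_root And (A ∨ C) (B ∨ D))
    (split_both (split_root And A B) (split_root And C D)).
Proof.
  exists (u_id _), (u_id _); simpl; split; [|easy].
  now rewrite !eqv_par_id, eqv_id_l, eqv_id_r, eqv_id_l.
Qed.

(** This is the axiom [eqv_ck_b_and], up to naturality; [factors_ck_right] is the same axiom with
    its associativities inverted. *)
Lemma factors_ck_left {L} (A B C D : formula L)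
    (s : splitting And A) (t : splitting And C) :
  factors (u_ck A B C D) (split_left And (B ∨ D) (split_both s t))
    (split_both (split_left And B s) (split_left And D t)).
Proof.
  exists (u_id _), (u_ck _ _ _ _); simpl; split; [|easy].
  rewrite par_compl, eqv_par_comp, !comp_assoc.
  rewrite <- (eqv_par_id _ Or B D), eqv_ck_nat.
  rewrite (eqv_assoc _ _ _ _ _ (b_from _ _ _ _)), (eqv_assoc _ _ _ _ _ (_ ∘ _)).
  rewrite eqv_par_id, eqv_ck_b_and. now rewrite !comp_assoc.
Qed.

Lemma factors_ck_right {L} (A B C D : formula L)
    (s : splitting And B) (t : splitting And D) :
  factors (u_ck A B C D) (split_right And (A ∨ C) (split_both s t))
    (split_both (split_right And A s) (split_right And C t)).
Proof.
  exists (u_ck _ _ _ _), (u_id _); simpl; split; [|easy].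
  rewrite par_compr, eqv_par_comp, !comp_assoc.
  rewrite <- (eqv_par_id _ Or A C), eqv_ck_nat.
  rewrite (eqv_assoc _ _ _ _ _ (b_to _ _ _ _)), (eqv_assoc _ _ _ _ _ (_ ∘ _)).
  rewrite eqv_par_id.
  rewrite (eqv_assoc _ _ _ _ _ (ck _ _ _ _)), (eqv_assoc _ _ _ _ _ (par And _ _)).
  apply comp_proper; [|easy].
  rewrite !eqv_assoc, comp_assoc. symmetry.
  apply (inverse_square (b_from And _ _ _ ∨ b_from And _ _ _)%term _ (b_from And _ _ _)).
  - apply par_inverse; apply eqv_b_from_to.
  - apply eqv_b_to_from.
  - rewrite eqv_assoc. apply eqv_ck_b_and.
Qed.

(** By induction on [f]: the place of the target cut dictates that of the source cut. An ∧-cut of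
    the target of [ck] becomes a simultaneous cut of both disjuncts of its source. *)
Lemma factor {L} {A B : formula L} (f : uterm A B) x (c : code x B) :
  exists d : code x A, factors f (split_at x B c) (split_at x A d).
Proof.
  revert x c. induction f; intros x0 c.
  - exists c, (u_id _), (u_id _); simpl; split; [|easy].
    now rewrite eqv_par_id, eqv_id_l, eqv_id_r.
  - destruct (IHf1 x0 c) as [d D], (IHf2 x0 d) as [e E].
    exists e. eapply factors_comp; eassumption.
  - destruct x0, x; simpl in c; try destruct c as [[]|[c|c]].
    all: try (destruct (IHf1 _ c) as [d D]; exists (inr (inl d)); now apply factors_par_left).
    all: try (destruct (IHf2 _ c) as [d D]; exists (inr (inr d)); now apply factors_par_right).
    all: try (exists (inl Root); apply factors_par_root).
    + destruct (IHf1 _ (fst c)) as [d D], (IHf2 _ (snd c)) as [e E].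
      exists (d, e). now apply factors_par_both.
    + destruct c.
  - destruct x0, x; simpl in c.
    2: exists (fst (fst c), (snd (fst c), snd c)); apply factors_b_both.
    2: destruct c.
    all: destruct c as [[]|[[[]|[c|c]]|c]].
    all: try (exists (inr (inr (inl Root))); apply factors_b_root).
    all: try (exists (inl Root); apply factors_b_left_root).
    all: try (exists (inr (inl c)); apply factors_b_left_left).
    all: try (exists (inr (inr (inr (inl c)))); apply factors_b_left_right).
    all: try (exists (inr (inr (inr (inr c)))); apply factors_b_right).
  - destruct x0, x; simpl in c.
    2: exists ((fst c, fst (snd c)), snd (snd c)); apply factors_b_both.
    2: destruct c.
    all: destruct c as [[]|[c|[[]|[c|c]]]].
    all: try (exists (inl Root); apply factors_b_root).
    all: try (exists (inr (inl (inl Root))); apply factors_b_left_root).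
    all: try (exists (inr (inl (inr (inl c)))); apply factors_b_left_left).
    all: try (exists (inr (inl (inr (inr c)))); apply factors_b_left_right).
    all: try (exists (inr (inr c)); apply factors_b_right).
  - destruct c.
  - destruct x0; [|destruct c]. destruct c as [[]|[c|c]].
    + exists (inl Root, inl Root). apply factors_ck_root.
    + exists (inr (inl (fst c)), inr (inl (snd c))). apply factors_ck_left.
    + exists (inr (inr (fst c)), inr (inr (snd c))). apply factors_ck_right.
Qed.

(** * Uniqueness of unit-free arrows *)

Fixpoint unitfree {L} (A : formula L) : Prop :=
  match A with
  | letter _ => True
  | cst _ => False
  | bin _ A B => unitfree A /\ unitfree B
  end.

Lemma uterm_unitfree {L} {A B : formula L} (f : uterm A B) : unitfree A <-> unitfree B.
Proof. induction f; simpl in *; tauto. Qed.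

Fixpoint flat {L K} {A : formula L} : deco K A -> list K :=
  match A with
  | letter _ => fun a => [a]
  | cst _ => fun _ => []
  | bin _ A B => fun a => flat (fst a) ++ flat (snd a)
  end.

Lemma trb_flat {L K} {A B : formula L} (f : uterm A B) (b : deco K B) :
  Permutation (flat (trb f b)) (flat b).
Proof.
  induction f; simpl; rewrite <- ?app_assoc; auto using Permutation_app.
  - now rewrite IHf2.
  - apply Permutation_app_head. rewrite !app_assoc.
    apply Permutation_app_tail, Permutation_app_comm.
Qed.

(** * Maximal cliques of letter occurrences *)

Definition same_conn (x y : conn) : bool :=
  match x, y with And, And | Or, Or => true | _, _ => false end.

(* The maximal [x]-cliques of letter occurrences, as words: two occurrences are
   joined when their lowest common connective is [x]. *)
Fixpoint clique {L K} (x : conn) {A : formula L} : deco K A -> list K -> Prop :=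
  match A with
  | letter _ => fun a w => w = [a]
  | cst y => fun _ w => x = y /\ w = []
  | bin y A B => fun a w =>
      if same_conn x y
      then exists w1 w2, clique x (fst a) w1 /\ clique x (snd a) w2 /\ w = w1 ++ w2
      else clique x (fst a) w \/ clique x (snd a) w
  end.

(** Associativities leave the words unchanged. [ck] only adds ∧-links: a clique of [A ∧ B] or of
    [C ∧ D] is, letter by letter, a clique of [(A ∨ C) ∧ (B ∨ D)]. Dually for ∨ in the other
    direction. *)
Lemma trb_clique_and {L K} {A B : formula L} (f : uterm A B) (b : deco K B) w :
  clique And (trb f b) w -> clique And b w.
Proof.
  revert w. induction f; simpl; intros w H; auto.
  - destruct x; simpl in *.
    + destruct H as (w1 & w2 & ? & ? & ->). eauto 7.
    + destruct H; eauto.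
  - destruct x; simpl in *; [|tauto].
    destruct H as (w1 & ? & ? & (w2 & w3 & ? & ? & ->) & ->).
    exists (w1 ++ w2), w3. rewrite app_assoc. eauto 7.
  - destruct x; simpl in *; [|tauto].
    destruct H as (? & w3 & (w1 & w2 & ? & ? & ->) & ? & ->).
    exists w1, (w2 ++ w3). rewrite app_assoc. eauto 7.
  - now destruct H.
  - destruct H as [(w1 & w2 & ? & ? & ->)|(w1 & w2 & ? & ? & ->)]; eauto 7.
Qed.

Lemma trb_clique_or {L K} {A B : formula L} (f : uterm A B) (b : deco K B) w :
  clique Or b w -> clique Or (trb f b) w.
Proof.
  revert w. induction f; simpl; intros w H; auto.
  - destruct x; simpl in *.
    + destruct H; eauto.
    + destruct H as (w1 & w2 & ? & ? & ->). eauto 7.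
  - destruct x; simpl in *; [tauto|].
    destruct H as (? & w3 & (w1 & w2 & ? & ? & ->) & ? & ->).
    exists w1, (w2 ++ w3). rewrite app_assoc. eauto 7.
  - destruct x; simpl in *; [tauto|].
    destruct H as (w1 & ? & ? & (w2 & w3 & ? & ? & ->) & ->).
    exists (w1 ++ w2), w3. rewrite app_assoc. eauto 7.
  - now destruct H.
  - destruct H as [(w1 & w2 & ? & ? & ->)|(w1 & w2 & ? & ? & ->)]; eauto 7.
Qed.

Lemma clique_through {L K} x {A : formula L} (a : deco K A) z :
  unitfree A -> In z (flat a) -> exists w, clique x a w /\ In z w.
Proof.
  (* The existence of some clique is carried along: it completes a clique through [z] in the
     opposite factor. *)
  enough (unitfree A -> (exists w, clique x a w) /\
    (In z (flat a) -> exists w, clique x a w /\ In z w)) by tauto.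
  induction A as [p|y|y A IHA B IHB]; simpl; [| |intros [HA HB]].
  - intros _; split; [|intros [<-|[]]]; eauto using in_eq.
  - now intros [].
  - destruct (IHA (fst a) HA) as [[wA EA] IA], (IHB (snd a) HB) as [[wB EB] IB].
    destruct (same_conn x y).
    + split; [eauto 7|]. intros [Hz|Hz]%in_app_or.
      * destruct (IA Hz) as (w & ? & ?). exists (w ++ wB); eauto 10 using in_or_app.
      * destruct (IB Hz) as (w & ? & ?). exists (wA ++ w); eauto 10 using in_or_app.
    + split; [eauto|]. intros [Hz|Hz]%in_app_or.
      * destruct (IA Hz) as (w & ? & ?); eauto.
      * destruct (IB Hz) as (w & ? & ?); eauto.
Qed.

Lemma clique_exists {L K} x {A : formula L} (a : deco K A) :
  unitfree A -> exists w, clique x a w.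
Proof.
  induction A as [p|y|y A IHA B IHB]; simpl; [eauto|tauto|intros [HA HB]].
  destruct (IHA (fst a) HA), (IHB (snd a) HB), (same_conn x y); eauto 7.
Qed.

Lemma clique_in_flat {L K} x {A : formula L} (a : deco K A) w z :
  clique x a w -> In z w -> In z (flat a).
Proof.
  revert w; induction A as [p|y|y A IHA B IHB]; simpl; intros w.
  - now intros ->.
  - now intros [_ ->].
  - rewrite in_app_iff. destruct (same_conn x y).
    + intros (w1 & w2 & ? & ? & ->). rewrite in_app_iff. intros [|]; eauto.
    + intros [|]; eauto.
Qed.

Lemma clique_not_nil {L K} x {A : formula L} (a : deco K A) w :
  unitfree A -> clique x a w -> exists z v, w = z :: v.
Proof.
  revert w; induction A as [p|y|y A IHA B IHB]; simpl; intros w; [|tauto|].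
  - intros _ ->; eauto.
  - intros [HA HB]. destruct (same_conn x y); [|intros [|]; eauto].
    intros (w1 & w2 & H1 & H2 & ->). destruct (IHA _ _ HA H1) as (z & v & ->).
    simpl; eauto.
Qed.

Definition before {K} (l : list K) (z z' : K) : Prop :=
  exists p q, l = p ++ z' :: q /\ In z p.

Lemma before_app_l {K} (l l' : list K) z z' : before l z z' -> before (l ++ l') z z'.
Proof.
  intros (p & q & -> & ?). exists p, (q ++ l'). now rewrite <- app_assoc.
Qed.

Lemma before_app_r {K} (l l' : list K) z z' : before l' z z' -> before (l ++ l') z z'.
Proof.
  intros (p & q & -> & ?). exists (l ++ p), q.
  rewrite <- app_assoc; auto using in_or_app.
Qed.

Lemma before_app {K} (l l' : list K) z z' : In z l -> In z' l' -> before (l ++ l') z z'.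
Proof.
  intros Hz (p & q & ->)%in_split. exists (l ++ p), q.
  rewrite <- app_assoc; auto using in_or_app.
Qed.

Lemma before_app_inv {K} (l l' : list K) z z' :
  before (l ++ l') z z' ->
  before l z z' \/ before l' z z' \/ (In z l /\ In z' l').
Proof.
  intros (p & q & E & Hz).
  apply app_eq_app in E as (r & [[-> E]|[-> ->]]).
  - destruct r as [|y r]; simpl in E.
    + rewrite app_nil_r. subst l'. auto using in_eq.
    + injection E as <- ->. left. now exists p, r.
  - right. rewrite in_app_iff in Hz. destruct Hz.
    + auto using in_or_app, in_eq.
    + left. now exists r, q.
Qed.

Lemma clique_before {L K} x {A : formula L} (a : deco K A) w z z' :
  clique x a w -> before w z z' -> before (flat a) z z'.
Proof.
  revert w; induction A as [p|y|y A IHA B IHB]; simpl; intros w.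
  - now intros ->.
  - now intros [_ ->].
  - destruct (same_conn x y).
    + intros (w1 & w2 & ? & ? & ->) [|[|[]]]%before_app_inv;
        eauto using before_app_l, before_app_r, before_app, clique_in_flat.
    + intros [|]; eauto using before_app_l, before_app_r.
Qed.

(** These are pairs whose order no unit-free arrow into [B] reverses, since ∨-cliques of the target
    survive as words in the source. *)
Definition or_before {L K} {B : formula L} (b : deco K B) (z z' : K) : Prop :=
  exists w, clique Or b w /\ before w z z'.

Definition diverge {K} (R : K -> K -> Prop) (w w' : list K) : Prop :=
  exists u z v z' v', w = u ++ z :: v /\ w' = u ++ z' :: v' /\ z <> z' /\ (R z z' \/ R z' z).

Lemma diverge_mono {K} (R S : K -> K -> Prop) u v v' w w' :
  (forall z z', R z z' -> S z z') ->
  diverge R w w' -> diverge S (u ++ w ++ v) (u ++ w' ++ v').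
Proof.
  intros RS (u0 & z & v0 & z' & v0' & -> & -> & ? & H).
  exists (u ++ u0), z, (v0 ++ v), z', (v0' ++ v').
  repeat split; rewrite <- ?app_assoc; simpl; auto.
  destruct H; auto.
Qed.

(** Two cliques agree until the first disjunction where they choose different sides, and the letters
    read there are joined by ∨. Cliques are nonempty, so neither word stops at that point. *)
Lemma cliques_diverge {L K} {B : formula L} (b : deco K B) w w' :
  unitfree B -> NoDup (flat b) -> clique And b w -> clique And b w' ->
  w = w' \/ diverge (or_before b) w w'.
Proof.
  revert w w'; induction B as [p|y|y A IHA B IHB]; simpl; intros w w'.
  - intros _ _ -> ->; auto.
  - tauto.
  - intros [HA HB] N. pose proof (NoDup_app_remove_l _ _ N) as NB.
    pose proof (NoDup_app_remove_r _ _ N) as NA.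
    assert (mono1 : forall z z', or_before (fst b) z z' ->
      @or_before L K (bin y A B) b z z').
    { intros z z' (v & Hv & Hz). destruct y; simpl.
      - exists v; simpl; auto.
      - destruct (clique_exists Or (snd b) HB) as [w2 ?].
        exists (v ++ w2); simpl; eauto 7 using before_app_l. }
    assert (mono2 : forall z z', or_before (snd b) z z' ->
      @or_before L K (bin y A B) b z z').
    { intros z z' (v & Hv & Hz). destruct y; simpl.
      - exists v; simpl; auto.
      - destruct (clique_exists Or (fst b) HA) as [w1 ?].
        exists (w1 ++ v); simpl; eauto 7 using before_app_r. }
    destruct y; simpl.
    + intros (w1 & w2 & H1 & H2 & ->) (w1' & w2' & H1' & H2' & ->).
      destruct (IHA _ _ _ HA NA H1 H1') as [<-|D].
      * destruct (IHB _ _ _ HB NB H2 H2') as [<-|D]; [auto|right].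
        rewrite <- (app_nil_r w2), <- (app_nil_r w2').
        exact (diverge_mono _ _ _ _ _ _ _ mono2 D).
      * right. exact (diverge_mono _ _ [] _ _ _ _ mono1 D).
    + assert (cross : forall v v', clique And (fst b) v -> clique And (snd b) v' ->
        diverge (@or_before L K (bin Or A B) b) v v' /\
        diverge (@or_before L K (bin Or A B) b) v' v).
      { intros v v' Hv Hv'.
        destruct (clique_not_nil _ _ _ HA Hv) as (z & u & ->).
        destruct (clique_not_nil _ _ _ HB Hv') as (z' & u' & ->).
        pose proof (clique_in_flat _ _ _ z Hv (in_eq _ _)) as Z.
        pose proof (clique_in_flat _ _ _ z' Hv' (in_eq _ _)) as Z'.
        assert (z <> z').
        { intros <-. apply in_split in Z as (l1 & l2 & E). rewrite E in N.
          rewrite <- app_assoc in N. apply NoDup_remove_2 in N.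
          apply N. rewrite !in_app_iff; auto. }
        assert (@or_before L K (bin Or A B) b z z').
        { destruct (clique_through Or _ _ HA Z) as (t & ? & ?).
          destruct (clique_through Or _ _ HB Z') as (t' & ? & ?).
          exists (t ++ t'); simpl; eauto 7 using before_app. }
        split.
        - exists [], z, u, z', u'; repeat split; auto.
        - exists [], z', u', z, u; repeat split; auto. }
      intros [H|H] [H'|H'].
      * destruct (IHA _ _ _ HA NA H H') as [<-|D]; [auto|right].
        rewrite <- (app_nil_r w), <- (app_nil_r w').
        exact (diverge_mono _ _ [] _ _ _ _ mono1 D).
      * right; apply (cross _ _ H H').
      * right; apply (cross _ _ H' H).
      * destruct (IHB _ _ _ HB NB H H') as [<-|D]; [auto|right].
        rewrite <- (app_nil_r w), <- (app_nil_r w').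
        exact (diverge_mono _ _ [] _ _ _ _ mono2 D).
Qed.

Lemma diverge_after {K} (R : K -> K -> Prop) u z v z' v' :
  diverge R (u ++ z :: v) (u ++ z' :: v') -> z = z' \/ R z z' \/ R z' z.
Proof.
  intros (u0 & z0 & v0 & z0' & v0' & E & E' & ne & H).
  revert u0 E E'; induction u as [|y u IH]; intros [|y0 u0]; simpl; intros E E'.
  - injection E as <- <-. injection E' as <- <-. auto.
  - injection E as -> _. injection E' as -> _. auto.
  - injection E as <- _. injection E' as <- _. easy.
  - injection E as <- E. injection E' as E'. eauto.
Qed.

Lemma before_NoDup_prefix {K} (D E : list K) z z' :
  NoDup (D ++ z' :: E) -> before (D ++ z' :: E) z z' -> In z D.
Proof.
  intros N (p & q & EQ & Hz). pose proof N as N'. rewrite EQ in N'.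
  enough (D = p) by now subst.
  apply app_eq_app in EQ as (r & [[-> EQ]|[-> EQ]]); destruct r as [|y r];
    rewrite ?app_nil_r; auto; simpl in EQ; injection EQ as <- ->.
  - apply NoDup_remove_2 in N. destruct N. rewrite !in_app_iff; simpl; auto.
  - apply NoDup_remove_2 in N'. destruct N'. rewrite !in_app_iff; simpl; auto.
Qed.

(** * Uniqueness of the matching of occurrences *)

Section Parsing.
Context {L K} {B : formula L} (b : deco K B).
Hypotheses (HB : unitfree B) (NB : NoDup (flat b)).

(** The trace on a subformula [X] of the source of the fact that ∧-cliques of the source are
    ∧-cliques of [B]: [u] is read before [X] and [v] after it. *)
Definition prefixes {X : formula L} (u : list K) (x : deco K X) : Prop :=
  forall w, clique And x w -> exists v, clique And b (u ++ w ++ v).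

Definition ordered (l : list K) : Prop :=
  NoDup l /\ forall z z', or_before b z z' -> before l z z'.

(* [x] and [y] are two ways of labelling the leaves of [X] by those of [B]; [D]
   lists the labels of the leaves before [X], and [u] those of the leaves before
   [X] in a maximal ∧-clique meeting [X]. *)
Lemma labelling_unique {X : formula L} (x y : deco K X) u D E E' :
  unitfree X -> ordered (D ++ flat x ++ E) -> ordered (D ++ flat y ++ E') ->
  prefixes u x -> prefixes u y -> x = y.
Proof.
  revert u D E E'; induction X as [p|c|c X IHX Y IHY]; simpl;
    intros u D E E' HX [Nx Ox] [Ny Oy] Px Py; [|easy|].
  - destruct (Px [x] eq_refl) as [v Hv], (Py [y] eq_refl) as [v' Hv']; simpl in *.
    destruct (cliques_diverge b _ _ HB NB Hv Hv') as [EQ|Dv].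
    { apply app_inv_head in EQ. now injection EQ. }
    apply diverge_after in Dv as [->|[R|R]]; auto; exfalso.
    (* Here [x] stands ∨-before [y] in [B], so the second labelling uses [x] within [D], whereas the
       first uses it only after [D]. *)
    + apply Oy, (before_NoDup_prefix _ _ _ _ Ny) in R.
      apply NoDup_remove_2 in Nx. apply Nx, in_or_app; auto.
    + apply Ox, (before_NoDup_prefix _ _ _ _ Nx) in R.
      apply NoDup_remove_2 in Ny. apply Ny, in_or_app; auto.
  - destruct HX as [HX HY], x as [x1 x2], y as [y1 y2]; simpl in *.
    assert (x1 = y1) as <-.
    { apply (IHX x1 y1 u D (flat x2 ++ E) (flat y2 ++ E')); auto;
        try (rewrite <- ?app_assoc in *; now split).
      - intros w Hw. destruct c.
        + destruct (clique_exists And x2 HY) as [w2 Hw2].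
          destruct (Px (w ++ w2)) as [v Hv]; [simpl; eauto 7|].
          exists (w2 ++ v). now rewrite <- app_assoc in Hv.
        + apply Px. simpl; auto.
      - intros w Hw. destruct c.
        + destruct (clique_exists And y2 HY) as [w2 Hw2].
          destruct (Py (w ++ w2)) as [v Hv]; [simpl; eauto 7|].
          exists (w2 ++ v). now rewrite <- app_assoc in Hv.
        + apply Py. simpl; auto. }
    f_equal.
    (* Right of an ∧, the word already read grows by a clique of the left side; right of an ∨,
       cliques avoid the left side and [u] stays. *)
    destruct c.
    + destruct (clique_exists And x1 HX) as [w1 Hw1].
      apply (IHY x2 y2 (u ++ w1) (D ++ flat x1) E E'); auto;
        try (rewrite <- ?app_assoc in *; now split).
      * intros w Hw. destruct (Px (w1 ++ w)) as [v Hv]; [simpl; eauto 7|].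
        exists v. now rewrite <- !app_assoc in *.
      * intros w Hw. destruct (Py (w1 ++ w)) as [v Hv]; [simpl; eauto 7|].
        exists v. now rewrite <- !app_assoc in *.
    + apply (IHY x2 y2 u (D ++ flat x1) E E'); auto;
        try (rewrite <- ?app_assoc in *; now split).
      * intros w Hw. apply Px; simpl; auto.
      * intros w Hw. apply Py; simpl; auto.
Qed.

Lemma trb_unique_NoDup {A : formula L} (f g : uterm A B) : trb f b = trb g b.
Proof.
  assert (ord : forall h : uterm A B, ordered ([] ++ flat (trb h b) ++ [])).
  { intros h. rewrite app_nil_r; simpl. split.
    - now rewrite trb_flat.
    - intros z z' (w & ? & ?). eauto using clique_before, trb_clique_or. }
  apply (labelling_unique _ _ [] [] [] []); auto.
  - now apply (uterm_unitfree f).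
  - intros w Hw. exists []. rewrite app_nil_r. now apply trb_clique_and in Hw.
  - intros w Hw. exists []. rewrite app_nil_r. now apply trb_clique_and in Hw.
Qed.

End Parsing.

(** * Colourings, and coherence of unit-free arrows *)

Fixpoint dmap {L K K'} (h : K -> K') {A : formula L} : deco K A -> deco K' A :=
  match A with
  | letter _ => h
  | cst _ => fun a => a
  | bin _ A B => fun a => (dmap h (fst a), dmap h (snd a))
  end.

Lemma trb_dmap {L K K'} (h : K -> K') {A B : formula L} (f : uterm A B) b :
  trb f (dmap h b) = dmap h (trb f b).
Proof. induction f; simpl; auto; congruence. Qed.

Fixpoint constant {L K} (k : K) (A : formula L) : deco K A :=
  match A with
  | letter _ => k
  | cst _ => tt
  | bin _ A B => (constant k A, constant k B)
  end.

Lemma trb_constant {L K} (k : K) {A B : formula L} (f : uterm A B) :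
  trb f (constant k B) = constant k A.
Proof. induction f; simpl; auto; congruence. Qed.

Lemma dmap_constant {L K K'} (h : K -> K') k {A : formula L} (a : deco K A) :
  (forall z, In z (flat a) -> h z = k) -> dmap h a = constant k A.
Proof.
  induction A; simpl; auto.
  - now destruct a.
  - intros H. f_equal; auto using in_or_app.
Qed.

Lemma numbering {L} (A : formula L) n :
  exists (a : deco nat A) m, NoDup (flat a) /\ forall z, In z (flat a) -> n <= z < m.
Proof.
  revert n; induction A as [p|y|y A IHA B IHB]; simpl; intros n.
  - exists n, (S n); split; [repeat constructor; easy|]. intros z [<-|[]]; lia.
  - exists tt, n; split; [constructor|easy].
  (* If [A] has no letters, nothing bounds [m] from below; starting at [n + m] keeps the labels of
     [B] at least [n] in every case. *)
  - destruct (IHA n) as (a & m & Na & Ha), (IHB (n + m)) as (b & k & Nb & Hb).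
    exists (a, b), (m + k); simpl; split.
    + apply NoDup_app; auto. intros z Hz Hz'. specialize (Ha z Hz).
      specialize (Hb z Hz'). lia.
    + intros z [Hz|Hz]%in_app_or; [specialize (Ha z Hz)|specialize (Hb z Hz)]; lia.
Qed.

(** With all leaves numbered differently the matching is unique. The numbers of [B] lie below [m]
    and those of [C] do not, so the two colours are a function of the number, and relabelling
    commutes with [trb]. *)
Lemma trb_two_colours {L} x {A B C : formula L} (f g : uterm A (bin x B C)) :
  unitfree (bin x B C) ->
  trb f (constant true B, constant false C) = trb g (constant true B, constant false C).
Proof.
  intros H. destruct (numbering B 0) as (b & m & Nb & Hb), (numbering C m) as (c & k & Nc & Hc).
  set (h := fun z => Nat.ltb z m).
  replace (constant true B, constant false C) with (@dmap L _ _ h (bin x B C) (b, c)).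
  - rewrite !trb_dmap. f_equal. apply trb_unique_NoDup; auto.
    simpl. apply NoDup_app; auto. intros z Hz Hz'. specialize (Hb z Hz).
    specialize (Hc z Hz'). lia.
  - simpl. f_equal; apply dmap_constant; intros z Hz; unfold h.
    + apply Nat.ltb_lt. now apply Hb.
    + apply Nat.ltb_ge. now apply Hc.
Qed.

Lemma constant_inj {L K} (k k' : K) (A : formula L) :
  unitfree A -> constant k A = constant k' A -> k = k'.
Proof.
  induction A; simpl; auto; [tauto|]. intros [? ?] [= ? ?]; auto.
Qed.

Definition bicoloured {L} {x} {A : formula L} (s : splitting x A) : deco bool A :=
  merge s (constant true _) (constant false _).

(** As [A] is unit-free, each side of a cut contains a letter, so both colours occur. *)
Lemma bicoloured_not_constant {L} x {A : formula L} (c : code x A) k :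
  unitfree A -> bicoloured (split_at x A c) <> constant k A.
Proof.
  revert k; induction A as [p|y|y A IHA B IHB]; simpl; [easy..|].
  intros k [HA HB].
  destruct x, y; simpl in *; try destruct c as [[]|[c|c]]; try now destruct c.
  all: unfold bicoloured; simpl; intros [= E E'].
  all: try (apply constant_inj in E, E'; congruence).
  all: try now apply IHA in E.
  all: now apply IHB in E'.
Qed.

(** The colouring shows the place of the cut: at the root if each factor has a single colour,
    otherwise inside the factor that shows both. For an ∧-cut of a disjunction the two disjuncts are
    treated separately. *)
Lemma bicoloured_inj {L} x {A : formula L} (c d : code x A) :
  unitfree A -> bicoloured (split_at x A c) = bicoloured (split_at x A d) -> c = d.
Proof.
  induction A as [p|y|y A IHA B IHB]; simpl; [easy..|].
  intros [HA HB]. destruct x, y; simpl in *; try now destruct c.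
  2: { destruct c, d; unfold bicoloured; simpl; intros [= E E']. f_equal; auto. }
  all: destruct c as [[]|[c|c]], d as [[]|[d|d]]; auto;
    unfold bicoloured; simpl; intros EQ; injection EQ; clear EQ; intros.
  all: try match goal with
       | E : merge ?s _ _ = constant _ _ |- _ => now apply bicoloured_not_constant in E
       | E : constant _ _ = merge ?s _ _ |- _ =>
           now symmetry in E; apply bicoloured_not_constant in E
       end.
  all: now repeat f_equal; auto.
Qed.

(* The equality proof makes the statement typable; nothing excludes that it is a
   nontrivial loop of [L], hence the proof irrelevance below. *)
Lemma uterm_to_letter {L} {A B : formula L} (f : uterm A B) :
  match B return term A B -> Prop with
  | letter q => fun f => exists e : letter q = A,
      f ≡ match e in _ = X return term X (letter q) with eq_refl => idt _ end
  | _ => fun _ => True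
  end (em f).
Proof.
  induction f; simpl; auto.
  - destruct A; auto. now exists eq_refl.
  - destruct C; auto. destruct IHf1 as [e E]. revert E. generalize (em f1).
    destruct e. intros t E. destruct IHf2 as [e E']. exists e.
    now rewrite E, eqv_id_l.
Qed.

Lemma unitfree_coherence {L} {A B : formula L} (f g : uterm A B) :
  unitfree B -> em f ≡ em g.
Proof.
  revert A f g; induction B as [q|y|x B IHB C IHC]; intros A f g H.
  - destruct (uterm_to_letter f) as [e ->], (uterm_to_letter g) as [e' ->].
    now rewrite (proof_irrelevance _ e e').
  - destruct H.
  - assert (HA : unitfree A) by now apply (uterm_unitfree f).
    assert (exists c : code x (bin x B C), split_at x _ c = split_root x B C)
      as [c Hc] by (destruct x; now exists (inl Root)).
    destruct (factor f x c) as [d D], (factor g x c) as [e E].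
    rewrite Hc in D, E. 
    destruct D as (f' & f'' & Ef & Mf), E as (g' & g'' & Eg & Mg); simpl in *.
    (* Both source cuts carry the colouring pulled back from [B] and [C], which is the same for [f]
       and [g]. *)
    assert (d = e) as <-.
    { apply (bicoloured_inj x); [easy|]. unfold bicoloured.
      rewrite <- (trb_constant true f'), <- (trb_constant false f''), <- Mf.
      rewrite <- (trb_constant true g'), <- (trb_constant false g''), <- Mg.
      now apply trb_two_colours. }
    rewrite eqv_id_l in Ef, Eg. destruct H.
    rewrite Ef, Eg, (IHB _ f' g'), (IHC _ f'' g''); easy.
Qed.

(** * Elimination of units *)

(* The status of a formula records what its normal form [nu A] is: a constant, or
   a formula with letters in which ⊥, respectively ⊤, occurs or not.  Arrows are
   monotone in the order [status_le], so that every formula on the way between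
   two pure ones is pure. *)
Inductive status :=
| constant_like (x : conn)
| mixed (has_bot has_top : bool).

(** Constants combine as truth values: [x] acts as conjunction or disjunction, with [cst x] neutral
    and the other constant absorbing. *)
Definition conn_mul (x y z : conn) : conn := if same_conn x y then z else y.

Definition status_bin (x : conn) (s t : status) : status :=
  match s, t with
  | constant_like y, constant_like z => constant_like (conn_mul x y z)
  | constant_like y, mixed b c | mixed b c, constant_like y =>
      if same_conn x y then mixed b c
      else match y with And => mixed b true | Or => mixed true c end
  | mixed b c, mixed b' c' => mixed (b || b') (c || c')
  end.

Fixpoint status_of {L} (A : formula L) : status :=
  match A with
  | letter _ => mixed false false
  | cst x => constant_like x
  | bin x A B => status_bin x (status_of A) (status_of B)
  end.

(** Between constants this is the direction of κ. In formulae with letters, arrows may lose ⊥ and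
    gain ⊤, never the reverse. *)
Definition status_le (s t : status) : bool :=
  match s, t with
  | constant_like Or, constant_like _ => true
  | constant_like And, constant_like And => true
  | mixed b c, mixed b' c' => implb b' b && implb c c'
  | _, _ => false
  end.

Definition good (s : status) : bool :=
  match s with
  | constant_like _ | mixed false false => true
  | _ => false
  end.

Ltac case_status s := destruct s as [[]|[] []].

Lemma status_le_trans s t r :
  status_le s t = true -> status_le t r = true -> status_le s r = true.
Proof. case_status s; case_status t; try easy; case_status r; easy. Qed.

Lemma status_bin_mono x s t s' t' :
  status_le s s' = true -> status_le t t' = true ->
  status_le (status_bin x s t) (status_bin x s' t') = true.
Proof.
  case_status s; case_status s'; try easy; intros _;
    case_status t; case_status t'; try easy; now destruct x.
Qed.

Lemma status_bin_assoc x s t r :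
  status_bin x s (status_bin x t r) = status_bin x (status_bin x s t) r.
Proof. case_status s; case_status t; case_status r; now destruct x. Qed.

Lemma status_ck s t r q :
  status_le (status_bin Or (status_bin And s t) (status_bin And r q))
    (status_bin And (status_bin Or s r) (status_bin Or t q)) = true.
Proof. case_status s; case_status t; case_status r; case_status q; reflexivity. Qed.

Lemma term_status_le {L} {A B : formula L} (f : term A B) :
  status_le (status_of A) (status_of B) = true.
Proof.
  assert (refl : forall s, status_le s s = true) by (intros s; now case_status s).
  induction f; simpl; auto.
  - eauto using status_le_trans.
  - auto using status_bin_mono.
  - rewrite status_bin_assoc. auto.
  - rewrite status_bin_assoc. auto.
  - generalize (status_of A); intros s; case_status s; now destruct x.
  - generalize (status_of A); intros s; case_status s; now destruct x.
  - generalize (status_of A); intros s; case_status s; now destruct x.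
  - generalize (status_of A); intros s; case_status s; now destruct x.
  - apply status_ck.
Qed.

(** Makes induction on composites possible. When letters are present, no ⊥ can appear after a source
    free of it, and no ⊤ can vanish before a target free of it. *)
Lemma good_between s t r : good s = true -> good r = true ->
  status_le s t = true -> status_le t r = true -> good t = true.
Proof. case_status s; case_status t; try easy; case_status r; easy. Qed.

Lemma good_bin_inv x s t : good (status_bin x s t) = true -> good s = true /\ good t = true.
Proof. case_status s; case_status t; now destruct x. Qed.

(* [nf] is [nu] with values in a type that separates the constants from the other
   formulae, so that [nf_bin] computes by cases; on impure formulae the value is
   junk. *)
Inductive nform (L : Type) :=
| nf_cst (x : conn)
| nf_form (t : formula L).
Arguments nf_cst {L} x.
Arguments nf_form {L} t%_form.

Definition form {L} (N : nform L) : formula L :=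
  match N with nf_cst x => cst x | nf_form t => t end.

Definition nf_bin {L} (x : conn) (M N : nform L) : nform L :=
  match M, N with
  | nf_cst y, nf_cst z => nf_cst (conn_mul x y z)
  | nf_cst y, nf_form t => if same_conn x y then nf_form t else nf_form (bin x (cst y) t)
  | nf_form s, nf_cst z => if same_conn x z then nf_form s else nf_form (bin x s (cst z))
  | nf_form s, nf_form t => nf_form (bin x s t)
  end.

Fixpoint nf {L} (A : formula L) : nform L :=
  match A with
  | letter p => nf_form (letter p)
  | cst x => nf_cst x
  | bin x A B => nf_bin x (nf A) (nf B)
  end.

Definition red_cst {L} (x y z : conn) :
    @term L (bin x (cst y) (cst z)) (cst (conn_mul x y z)) :=
  match x, y, z with
  | And, And, And => delta_to And _
  | And, And, Or => sigma_to And _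
  | And, Or, And => delta_to And _
  | And, Or, Or => wbot_to
  | Or, Or, Or => delta_to Or _
  | Or, Or, And => sigma_to Or _
  | Or, And, Or => delta_to Or _
  | Or, And, And => wtop_to
  end.

Definition red_cst_form {L} (x y : conn) (t : formula L) :
    term (bin x (cst y) t) (form (nf_bin x (nf_cst y) (nf_form t))) :=
  match x, y with
  | And, And => sigma_to And t
  | Or, Or => sigma_to Or t
  | _, _ => idt _
  end.

Definition red_form_cst {L} (x y : conn) (t : formula L) :
    term (bin x t (cst y)) (form (nf_bin x (nf_form t) (nf_cst y))) :=
  match x, y with
  | And, And => delta_to And t
  | Or, Or => delta_to Or t
  | _, _ => idt _
  end.

Definition red {L} (x : conn) (M N : nform L) :
    term (bin x (form M) (form N)) (form (nf_bin x M N)) :=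
  match M, N with
  | nf_cst y, nf_cst z => red_cst x y z
  | nf_cst y, nf_form t => red_cst_form x y t
  | nf_form s, nf_cst z => red_form_cst x z s
  | nf_form s, nf_form t => idt _
  end.

Fixpoint norm {L} (A : formula L) : term A (form (nf A)) :=
  match A with
  | letter p => idt _
  | cst x => idt _
  | bin x A B => red x (nf A) (nf B) ∘ par x (norm A) (norm B)
  end.

Lemma red_mono {L} x (M N : nform L) : exists r, r ∘ red x M N ≡ idt _.
Proof.
  destruct x, M as [[]|s], N as [[]|t]; simpl; eexists;
    first [ apply eqv_delta_from_to | apply eqv_sigma_from_to
          | apply eqv_wbot_from_to | apply eqv_wtop_from_to | apply eqv_id_l ].
Qed.

Lemma norm_mono {L} (A : formula L) : exists r, r ∘ norm A ≡ idt A.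
Proof.
  induction A as [p|y|x A [r Hr] B [s Hs]]; simpl; try (exists (idt _); apply eqv_id_l).
  destruct (red_mono x (nf A) (nf B)) as [q Hq].
  exists (par x r s ∘ q). rewrite comp_assoc, (precomp1 _ _ _ Hq), eqv_id_l.
  now apply par_inverse.
Qed.

Definition nf_status {L} (N : nform L) : status :=
  match N with nf_cst x => constant_like x | nf_form _ => mixed false false end.

Lemma good_nf {L} (A : formula L) : good (status_of A) = true ->
  status_of A = nf_status (nf A) /\
  match nf A with nf_cst _ => True | nf_form t => unitfree t end.
Proof.
  induction A as [p|y|x A IHA B IHB]; simpl; auto.
  intros G. destruct (good_bin_inv _ _ _ G) as [GA GB].
  destruct (IHA GA) as [EA UA], (IHB GB) as [EB UB]. rewrite EA, EB in *.
  destruct x, (nf A) as [[]|s], (nf B) as [[]|t]; simpl in *; auto; discriminate.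
Qed.

(** * Naturality of normalisation *)

Lemma unit_left_assoc {L} x (B C N : formula L) (k : term (bin x B C) N)
    (s : term (bin x (cst x) B) B) (s' : term (bin x (cst x) N) N) :
  s ≡ sigma_to x B -> s' ≡ sigma_to x N ->
  k ∘ par x s (idt C) ∘ b_to x (cst x) B C ≡ idt N ∘ (s' ∘ par x (idt (cst x)) k).
Proof.
  intros -> ->. now rewrite comp_assoc, sigma_to_bin, eqv_id_l, eqv_sigma_nat.
Qed.

Lemma unit_mid_assoc {L} x (A C N : formula L) (k : term (bin x A C) N)
    (s : term (bin x (cst x) C) C) (d : term (bin x A (cst x)) A) :
  s ≡ sigma_to x C -> d ≡ delta_to x A ->
  k ∘ par x d (idt C) ∘ b_to x A (cst x) C ≡ idt N ∘ (k ∘ par x (idt A) s).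
Proof. intros -> ->. now rewrite comp_assoc, triangle, eqv_id_l. Qed.

Lemma unit_right_assoc {L} x (A B N : formula L) (k : term (bin x A B) N)
    (d : term (bin x B (cst x)) B) (d' : term (bin x N (cst x)) N) :
  d ≡ delta_to x B -> d' ≡ delta_to x N ->
  d' ∘ par x k (idt (cst x)) ∘ b_to x A B (cst x) ≡ idt N ∘ (k ∘ par x (idt A) d).
Proof.
  intros -> ->. now rewrite <- eqv_delta_nat, comp_assoc, delta_to_bin, eqv_id_l.
Qed.

Lemma inverse_unique {L} {A B : formula L} (p p' : term A B) (q q' : term B A) :
  p ∘ q ≡ idt B -> q ≡ q' -> q' ∘ p' ≡ idt A -> p ≡ p'.
Proof.
  intros pq qq qp. rewrite <- (eqv_id_r _ _ _ p), <- qp, <- qq, eqv_assoc, pq.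
  apply eqv_id_l.
Qed.

(** The axiom is coassociativity of [wbot_from]; here the inverses of its two sides are compared. *)
Lemma wbot_to_assoc {L} :
  wbot_to ∘ (wbot_to ∧ idt ⊥) ∘ b_to And ⊥ ⊥ ⊥
  ≡ idt (L := L) ⊥ ∘ (wbot_to ∘ (idt ⊥ ∧ wbot_to)).
Proof.
  pose proof (eqv_wbot_to_from L) as TF. pose proof (eqv_wbot_from_to L) as FT.
  rewrite eqv_id_l. eapply inverse_unique; [| apply eqv_wbot_assoc |].
  - rewrite !comp_assoc, (precomp1 _ _ _ (eqv_b_to_from _ And ⊥ ⊥ ⊥)), eqv_id_l.
    rewrite (precomp1 (wbot_to ∧ idt ⊥) (wbot_from ∧ idt ⊥) (idt _)).
    + now rewrite eqv_id_l.
    + now apply par_inverse; [|apply eqv_id_l].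
  - rewrite comp_assoc, (precomp1 _ _ _ FT), eqv_id_l.
    now apply par_inverse; [apply eqv_id_l|].
Qed.

(** At ⊤ ∧ ⊤ and ⊥ ∨ ⊥ both unit arrows apply and [red_cst] picks one. Lemmas that take a unit arrow
    as a variable accept either choice, leaving such equations. *)
Ltac units := first [ reflexivity | apply eqv_delta_sigma | symmetry; apply eqv_delta_sigma ].

(** Goodness leaves two situations: a constant is absorbed and both normal forms coincide, or all
    three are formulae and an associativity remains. *)
Lemma red_assoc {L} x (M N P : nform L) :
  good (status_bin x (nf_status M) (status_bin x (nf_status N) (nf_status P))) = true ->
  exists (u : uterm (form (nf_bin x M (nf_bin x N P))) (form (nf_bin x (nf_bin x M N) P)))
    (v : uterm (form (nf_bin x (nf_bin x M N) P)) (form (nf_bin x M (nf_bin x N P)))),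
    em u ∘ em v ≡ idt _ /\ em v ∘ em u ≡ idt _ /\
    red x (nf_bin x M N) P ∘ par x (red x M N) (idt (form P))
      ∘ b_to x (form M) (form N) (form P)
    ≡ em u ∘ (red x M (nf_bin x N P) ∘ par x (idt (form M)) (red x N P)).
Proof.
  destruct x, M as [[]|], N as [[]|], P as [[]|]; cbn; try discriminate; intros _.
  all: match goal with
       | |- exists (u : uterm ?A ?A) v, _ => exists (u_id _), (u_id _)
       | |- _ => exists (u_b_to _ _ _ _), (u_b_from _ _ _ _)
       end; cbn;
    (split; [first [apply eqv_id_l | apply eqv_b_to_from] |
     split; [first [apply eqv_id_l | apply eqv_b_from_to] |]]).
  all: first
    [ apply unit_left_assoc; units
    | apply unit_mid_assoc; units
    | apply unit_right_assoc; units
    | apply wbot_to_assoc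
    | rewrite eqv_id_l; apply eqv_wtop_assoc
    | now rewrite !eqv_par_id, !eqv_id_l, !eqv_id_r ].
Qed.

(** Only identities, κ and their composites start from a constant, so such a path stays among
    constants. [False] marks the impossible targets, which the composition case has to exclude. *)
Lemma uterm_from_cst {L} {A B : formula L} (u : uterm A B) :
  match A, B return term A B -> Prop with
  | cst And, cst And => fun f => f ≡ idt ⊤
  | cst Or, cst Or => fun f => f ≡ idt ⊥
  | cst Or, cst And => fun f => f ≡ kappa
  | cst _, _ => fun _ => False
  | _, _ => fun _ => True
  end (em u).
Proof.
  induction u; cbn; try easy.
  - now destruct A as [|[]|].
  - destruct A as [|[]|], B as [|[]|], C as [|[]|]; simpl in *; try easy;
      rewrite IHu1, IHu2; first [apply eqv_id_l | apply eqv_id_r].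
Qed.

Lemma wbot_to_kappa_r {L} : delta_to And ⊥ ∘ (idt ⊥ ∧ kappa) ≡ @wbot_to L.
Proof.
  apply (epi_of_section wbot_from wbot_to); [apply eqv_wbot_from_to|].
  rewrite comp_assoc, <- eqv_kappa_bot_r, eqv_delta_to_from, eqv_wbot_to_from.
  reflexivity.
Qed.

Lemma wbot_to_kappa_l {L} : sigma_to And ⊥ ∘ (kappa ∧ idt ⊥) ≡ @wbot_to L.
Proof.
  apply (epi_of_section wbot_from wbot_to); [apply eqv_wbot_from_to|].
  rewrite comp_assoc, <- eqv_kappa_bot_l, eqv_sigma_to_from, eqv_wbot_to_from.
  reflexivity.
Qed.

Lemma wbot_to_kappa {L} :
  delta_to And ⊤ ∘ (kappa ∧ kappa) ≡ kappa ∘ @wbot_to L.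
Proof.
  rewrite <- wbot_to_kappa_r, eqv_assoc, eqv_delta_nat, comp_assoc, comp_par.
  now rewrite eqv_id_l, eqv_id_r.
Qed.

Lemma wtop_to_kappa {L} :
  @wtop_to L ∘ (kappa ∨ kappa) ≡ kappa ∘ delta_to Or ⊥.
Proof.
  rewrite eqv_delta_nat, eqv_kappa_top_r, comp_assoc, comp_par.
  now rewrite eqv_id_l, eqv_id_r.
Qed.

(** Constants move only by identities and κ, so every case is naturality of a unit isomorphism or
    one of the laws relating κ to [wbot_to] and [wtop_to]. *)
Lemma red_nat {L} x (M M' N N' : nform L)
    (u : uterm (form M) (form M')) (v : uterm (form N) (form N')) :
  status_le (nf_status M) (nf_status M') = true ->
  status_le (nf_status N) (nf_status N') = true ->
  good (status_bin x (nf_status M) (nf_status N)) = true ->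
  good (status_bin x (nf_status M') (nf_status N')) = true ->
  exists w : uterm (form (nf_bin x M N)) (form (nf_bin x M' N')),
    red x M' N' ∘ par x (em u) (em v) ≡ em w ∘ red x M N.
Proof.
  pose proof (uterm_from_cst u) as U. pose proof (uterm_from_cst v) as V.
  destruct M as [[]|], M' as [[]|]; try easy;
    destruct N as [[]|], N' as [[]|]; try easy; destruct x; try easy;
    intros _ _ _ _; cbn in u, v, U, V |- *.
  all: lazymatch goal with
    | |- exists w : uterm (cst ?x) (cst ?x), _ => exists (u_id _)
    | |- exists w : uterm (cst _) (cst _), _ => exists u_kappa
    | |- exists w : uterm (bin ?x _ _) _, _ => exists (u_par x u v)
    | |- exists w : uterm ?A ?B, _ => first [exists u | exists v]
    end; cbn; try rewrite U; try rewrite V.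
  all: rewrite ?eqv_par_id, ?eqv_id_l, ?eqv_id_r; try reflexivity.
  all: rewrite ?wbot_to_kappa_r, ?wbot_to_kappa_l, ?wbot_to_kappa, ?wtop_to_kappa,
    <- ?eqv_kappa_top_r, <- ?eqv_kappa_top_l; try reflexivity.
  all: symmetry; first [apply eqv_delta_nat | apply eqv_sigma_nat | idtac].
  all: rewrite ?eqv_delta_sigma; apply eqv_sigma_nat.
Qed.

Section CkUnits.
Context {L : Type} (A B N : formula L).

(** In this section [k] stands for the reduction that remains once the units are removed. *)
Lemma ck_bot_right (k : term (A ∧ B) N) (dA : term (A ∨ ⊥) A)
    (dB : term (B ∨ ⊥) B) (dN : term (N ∨ ⊥) N) :
  dA ≡ delta_to Or A -> dB ≡ delta_to Or B -> dN ≡ delta_to Or N ->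
  k ∘ (dA ∧ dB) ∘ ck A B ⊥ ⊥ ≡ idt N ∘ (dN ∘ (k ∨ wbot_to)).
Proof.
  intros -> -> ->. rewrite eqv_id_l.
  rewrite <- (eqv_id_r _ _ _ k) at 2. rewrite <- (eqv_id_l _ _ _ wbot_to).
  rewrite eqv_par_comp, eqv_assoc, <- eqv_delta_nat, eqv_ck_delta_or, !comp_assoc.
  rewrite comp_par, eqv_wbot_from_to, eqv_id_l, eqv_par_id. now rewrite eqv_id_r.
Qed.

Lemma ck_bot_left (k : term (A ∧ B) N) (dA : term (⊥ ∨ A) A)
    (dB : term (⊥ ∨ B) B) (dN : term (⊥ ∨ N) N) :
  dA ≡ sigma_to Or A -> dB ≡ sigma_to Or B -> dN ≡ sigma_to Or N ->
  k ∘ (dA ∧ dB) ∘ ck ⊥ ⊥ A B ≡ idt N ∘ (dN ∘ (wbot_to ∨ k)).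
Proof.
  intros -> -> ->. rewrite eqv_id_l.
  rewrite <- (eqv_id_r _ _ _ k) at 2. rewrite <- (eqv_id_l _ _ _ wbot_to).
  rewrite eqv_par_comp, eqv_assoc, <- eqv_sigma_nat, eqv_ck_sigma_or, !comp_assoc.
  rewrite comp_par, eqv_wbot_from_to, eqv_id_l, eqv_par_id. now rewrite eqv_id_r.
Qed.

Lemma ck_top_right (k : term (A ∨ B) N) (dA : term (A ∧ ⊤) A)
    (dB : term (B ∧ ⊤) B) (dN : term (N ∧ ⊤) N) :
  dA ≡ delta_to And A -> dB ≡ delta_to And B -> dN ≡ delta_to And N ->
  dN ∘ (k ∧ wtop_to) ∘ ck A ⊤ B ⊤ ≡ idt N ∘ (k ∘ (dA ∨ dB)).
Proof.
  intros -> -> ->. rewrite eqv_id_l.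
  rewrite <- (eqv_id_r _ _ _ k) at 1. rewrite <- (eqv_id_l _ _ _ wtop_to).
  rewrite eqv_par_comp, eqv_assoc, <- eqv_delta_nat, !comp_assoc.
  apply comp_proper; [easy|].
  (* The axiom is about [delta_from], so both sides are compared after precomposition with it. *)
  apply (epi_of_section (delta_from And A ∨ delta_from And B)
    (delta_to And A ∨ delta_to And B)).
  { apply par_inverse; apply eqv_delta_from_to. }
  rewrite !comp_assoc, (eqv_assoc _ _ _ _ _ (idt _ ∧ _)), <- eqv_ck_delta_and.
  now rewrite comp_par, !eqv_delta_to_from, eqv_par_id.
Qed.

Lemma ck_top_left (k : term (A ∨ B) N) (dA : term (⊤ ∧ A) A)
    (dB : term (⊤ ∧ B) B) (dN : term (⊤ ∧ N) N) :
  dA ≡ sigma_to And A -> dB ≡ sigma_to And B -> dN ≡ sigma_to And N ->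
  dN ∘ (wtop_to ∧ k) ∘ ck ⊤ A ⊤ B ≡ idt N ∘ (k ∘ (dA ∨ dB)).
Proof.
  intros -> -> ->. rewrite eqv_id_l.
  rewrite <- (eqv_id_r _ _ _ k) at 1. rewrite <- (eqv_id_l _ _ _ wtop_to).
  rewrite eqv_par_comp, eqv_assoc, <- eqv_sigma_nat, !comp_assoc.
  apply comp_proper; [easy|].
  apply (epi_of_section (sigma_from And A ∨ sigma_from And B)
    (sigma_to And A ∨ sigma_to And B)).
  { apply par_inverse; apply eqv_sigma_from_to. }
  rewrite !comp_assoc, (eqv_assoc _ _ _ _ _ (_ ∧ idt _)), <- eqv_ck_sigma_and.
  now rewrite comp_par, !eqv_sigma_to_from, eqv_par_id.
Qed.

End CkUnits.

(** Unless all four are formulae, goodness forces a pair of units: ⊥, ⊥ as one disjunct or ⊤, ⊤ in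
    matching positions. The sole exceptions, ⊤, ⊥, ⊥, ⊤ and ⊥, ⊤, ⊤, ⊥, are the two axioms of [ck]
    that involve κ. *)
Lemma red_ck {L} (M N P Q : nform L) :
  good (status_bin Or (status_bin And (nf_status M) (nf_status N))
    (status_bin And (nf_status P) (nf_status Q))) = true ->
  good (status_bin And (status_bin Or (nf_status M) (nf_status P))
    (status_bin Or (nf_status N) (nf_status Q))) = true ->
  exists u : uterm (form (nf_bin Or (nf_bin And M N) (nf_bin And P Q)))
      (form (nf_bin And (nf_bin Or M P) (nf_bin Or N Q))),
    red And (nf_bin Or M P) (nf_bin Or N Q) ∘ (red Or M P ∧ red Or N Q)
      ∘ ck (form M) (form N) (form P) (form Q)
    ≡ em u ∘ (red Or (nf_bin And M N) (nf_bin And P Q)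
      ∘ (red And M N ∨ red And P Q)).
Proof.
  destruct M as [[]|], N as [[]|], P as [[]|], Q as [[]|]; try easy; intros _ _; cbn.
  all: match goal with
    | |- exists u : uterm ?A ?A, _ => exists (u_id A)
    | |- exists u : uterm (cst _) (cst _), _ => exists u_kappa
    | |- _ => exists (u_ck _ _ _ _)
    end; cbn.
  all: first
    [ apply ck_bot_right; units
    | apply ck_bot_left; units
    | apply ck_top_right; units
    | apply ck_top_left; units
    | idtac ].
  all: rewrite ?eqv_par_id, ?eqv_id_l, ?eqv_id_r; try reflexivity.
  all: rewrite (eqv_assoc _ _ _ _ _ kappa).
  - apply eqv_ck_kappa_1.
  - apply eqv_ck_kappa_2.
Qed.

Lemma red_unit_right {L} x (M : nform L) :
  exists (u : uterm (form (nf_bin x M (nf_cst x))) (form M))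
    (v : uterm (form M) (form (nf_bin x M (nf_cst x)))),
    em v ∘ em u ≡ idt _ /\ delta_to x (form M) ≡ em u ∘ red x M (nf_cst x).
Proof.
  destruct x, M as [[]|]; cbn; exists (u_id _), (u_id _); cbn;
    rewrite !eqv_id_l; split; units.
Qed.

Lemma red_unit_left {L} x (M : nform L) :
  exists (u : uterm (form (nf_bin x (nf_cst x) M)) (form M))
    (v : uterm (form M) (form (nf_bin x (nf_cst x) M))),
    em v ∘ em u ≡ idt _ /\ sigma_to x (form M) ≡ em u ∘ red x (nf_cst x) M.
Proof.
  destruct x, M as [[]|]; cbn; exists (u_id _), (u_id _); cbn;
    rewrite !eqv_id_l; split; units.
Qed.

Lemma norm_nat {L} {A B : formula L} (f : term A B) :
  good (status_of A) = true -> good (status_of B) = true ->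
  exists u : uterm (form (nf A)) (form (nf B)), norm B ∘ f ≡ em u ∘ norm A.
Proof.
  induction f; intros GA GB.
  - exists (u_id _); simpl. now rewrite eqv_id_l, eqv_id_r.
  - assert (GM : good (status_of B) = true)
      by apply (good_between _ _ _ GA GB (term_status_le f2) (term_status_le f1)).
    destruct (IHf1 GM GB) as [u U], (IHf2 GA GM) as [v V].
    exists (u_comp u v); simpl. now rewrite eqv_assoc, U, comp_assoc, V, eqv_assoc.
  - destruct (good_bin_inv _ _ _ GA) as [GA1 GA2], (good_bin_inv _ _ _ GB) as [GB1 GB2].
    destruct (IHf1 GA1 GB1) as [u U], (IHf2 GA2 GB2) as [v V].
    pose proof (term_status_le f1) as L1. pose proof (term_status_le f2) as L2.
    simpl in GA, GB.
    rewrite (proj1 (good_nf _ GA1)), (proj1 (good_nf _ GA2)) in *.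
    rewrite (proj1 (good_nf _ GB1)), (proj1 (good_nf _ GB2)) in *.
    destruct (red_nat x _ _ _ _ u v L1 L2 GA GB) as [w W].
    exists w; simpl. rewrite comp_assoc, comp_par, U, V, <- comp_par.
    now rewrite !eqv_assoc, W.
  - simpl in GA.
    destruct (good_bin_inv _ _ _ GA) as [GA1 [GA2 GA3]%good_bin_inv].
    rewrite (proj1 (good_nf _ GA1)), (proj1 (good_nf _ GA2)), (proj1 (good_nf _ GA3)) in GA.
    destruct (red_assoc x _ _ _ GA) as (u & v & _ & _ & E).
    exists u; simpl. rewrite par_compl, par_compr, !comp_assoc, eqv_b_nat.
    pose proof (comp_proper _ _ _ _ _ E _ _
      (eqv_refl _ _ _ (par x (norm A) (par x (norm B) (norm C))))) as E'.
    rewrite !comp_assoc in E'. exact E'.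
  - simpl in GB.
    destruct (good_bin_inv _ _ _ GB) as [GB1 [GB2 GB3]%good_bin_inv].
    rewrite (proj1 (good_nf _ GB1)), (proj1 (good_nf _ GB2)), (proj1 (good_nf _ GB3)) in GB.
    destruct (red_assoc x _ _ _ GB) as (u & v & UV & VU & E).
    exists v; simpl.
    apply (inverse_square (b_to x A B C) _ (em u)); [apply eqv_b_to_from | easy |].
    symmetry. rewrite par_compl, par_compr, !comp_assoc, eqv_b_nat.
    pose proof (comp_proper _ _ _ _ _ E _ _
      (eqv_refl _ _ _ (par x (norm A) (par x (norm B) (norm C))))) as E'.
    rewrite !comp_assoc in E'. exact E'.
  - destruct (red_unit_right x (nf A)) as (u & v & VU & E).
    exists u; simpl. now rewrite eqv_delta_nat, E, comp_assoc.
  - destruct (red_unit_right x (nf A)) as (u & v & VU & E). exists v; simpl.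
    apply (inverse_square (delta_to x A) _ (em u)); [apply eqv_delta_to_from | easy |].
    now rewrite eqv_delta_nat, E, comp_assoc.
  - destruct (red_unit_left x (nf A)) as (u & v & VU & E).
    exists u; simpl. now rewrite eqv_sigma_nat, E, comp_assoc.
  - destruct (red_unit_left x (nf A)) as (u & v & VU & E). exists v; simpl.
    apply (inverse_square (sigma_to x A) _ (em u)); [apply eqv_sigma_to_from | easy |].
    now rewrite eqv_sigma_nat, E, comp_assoc.
  - exists (u_id _); cbn. now rewrite eqv_par_id, !eqv_id_l, eqv_id_r.
  - exists (u_id _); cbn. now rewrite eqv_par_id, eqv_id_r, eqv_id_l, eqv_wbot_to_from.
  - exists (u_id _); cbn. now rewrite eqv_par_id, !eqv_id_l, eqv_id_r.
  - exists (u_id _); cbn. now rewrite eqv_par_id, eqv_id_r, eqv_id_l, eqv_wtop_to_from.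
  - exists u_kappa; cbn. now rewrite eqv_id_l, eqv_id_r.
  - simpl in GA, GB.
    destruct (good_bin_inv _ _ _ GA) as [[GA1 GA2]%good_bin_inv [GA3 GA4]%good_bin_inv].
    rewrite (proj1 (good_nf _ GA1)), (proj1 (good_nf _ GA2)),
      (proj1 (good_nf _ GA3)), (proj1 (good_nf _ GA4)) in GA, GB.
    destruct (red_ck _ _ _ _ GA GB) as [u E].
    exists u; simpl. rewrite !eqv_par_comp, !comp_assoc, eqv_ck_nat.
    pose proof (comp_proper _ _ _ _ _ E _ _
      (eqv_refl _ _ _ ((norm A ∧ norm B) ∨ (norm C ∧ norm D)))) as E'.
    rewrite !comp_assoc in E'. exact E'.
Qed.

(** [norm B] is mono, so it suffices to compare the unit-free arrows between normal forms. By
    monotonicity of the status these are both constants or both formulae without constants. *)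
Lemma good_coherence {L} {A B : formula L} (f g : term A B) :
  good (status_of A) = true -> good (status_of B) = true -> f ≡ g.
Proof.
  intros GA GB. destruct (norm_nat f GA GB) as [u U], (norm_nat g GA GB) as [v V].
  destruct (norm_mono B) as [r R]. apply (mono_of_retraction (norm B) r); [easy|].
  rewrite U, V. apply comp_proper; [|easy].
  pose proof (term_status_le f) as LE.
  destruct (good_nf _ GA) as [EA UA], (good_nf _ GB) as [EB UB].
  rewrite EA, EB in LE. clear U V r R.
  pose proof (uterm_from_cst u) as U. pose proof (uterm_from_cst v) as V.
  destruct (nf A) as [[]|], (nf B) as [[]|]; try easy; simpl in *;
    first [now rewrite U, V | now apply unitfree_coherence].
Qed.

(** Connects the status with purity, which is stated through [nu]. *)
Lemma status_nu {L} (A : formula L) : status_of (nu A) = status_of A.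
Proof.
  induction A as [p|y|x A IHA B IHB]; simpl; auto. rewrite <- IHA, <- IHB.
  unfold nu_bin.
  destruct (nu A) as [|[]|], (nu B) as [|[]|], x; simpl; try easy;
    match goal with |- ?s = _ => case_status s; easy | _ => idtac end.
Qed.

Lemma pure_good {L} (A : formula L) : pure A -> good (status_of A) = true.
Proof.
  unfold pure. rewrite <- status_nu. generalize (nu A) as N. intros N [HT HB].
  enough (status_of N = mixed false false) as -> by easy.
  induction N as [p|[]|x M IHM N IHN]; simpl in *; auto; try easy.
  rewrite IHM, IHN; tauto.
Qed.

Lemma letterless_good {L} (A : formula L) : letterless A -> good (status_of A) = true.
Proof.
  intros H. enough (exists x, status_of A = constant_like x) as [x ->] by easy.
  induction A as [p|x|x A IHA B IHB]; simpl.
  - now destruct (H p).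
  - eauto.
  - destruct IHA as [y Hy]; [intros p Hp; apply (H p); simpl; auto|].
    destruct IHB as [z Hz]; [intros p Hp; apply (H p); simpl; auto|].
    rewrite Hy, Hz; simpl; eauto.
Qed.

Theorem mainTheorem3 (L : Type) (L_nonempty : inhabited L)
    (A B : formula L) (f g : term A B)
    (H : (pure A /\ pure B) \/ (letterless A /\ letterless B)) :
  f ≡ g.
Proof.
  apply good_coherence; destruct H as [[]|[]];
    auto using pure_good, letterless_good.
Qed.
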